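(* Let $n\ge1$, $\mu=(\mu_1,\dots,\mu_n)\in\mathbb R^n$, and $H_\mu=J+V_\mu$ with $V_\mu=\mathrm{diag}(2\mu_1,\mu_2,\dots,\mu_n,0,0,\dots)$. Suppose that $H_\mu$ has a virtual level at its left threshold $\lambda=0$. Then there is a unique $k$, $0\le k\le n-1$, such that $$\mu\in\mathrm{Graph}\big((\Phi_{n-1}+1)|_{D_k^{(n-1)}}\big).$$ In this case, $H_\mu$ has a threshold resonance at $\lambda=0$ and exactly $k$ simple eigenvalues on the negative real axis.
   Context: The free Jacobi operator $J$ on $\ell^2(\mathbb N)$, $\mathbb N=\{1,2,\dots\}$, is given by the tridiagonal matrix with diagonal entries all equal to $2$ and off-diagonal entries $a_1=-\sqrt2$, $a_k=-1$ ($k\ge2$), where $a_k$ is the $(k,k+1)$ and $(k+1,k)$ entry; its spectrum is $[0,4]$. $H_\mu$ has a virtual level at the left threshold $0$ if it is critical there, i.e. the function $\nu\mapsto\mathrm{tr}\,E_{H_\nu}((-\infty,0))$ on $\mathbb R^n$ is discontinuous at $\nu=\mu$, where $E_A$ is the spectral measure of a self-adjoint operator $A$. A threshold resonance (virtual state) at $\lambda=0$ is a nonzero bounded sequence $\Psi=\{\Psi_k\}_{k\ge1}$ solving $H_\mu\Psi=0$ entrywise. Let $Q_0=1$, $Q_1=1+\mu_1$, $Q_{n+1}=(2+\mu_{n+1})Q_n-Q_{n-1}$ for $n\ge1$, and $\Phi_n=Q_{n-1}/Q_n-2$ on $\mathrm{Dom}(\Phi_n)=\{\mu\in\mathbb R^n:Q_n(\mu)\ne0\}$,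 $n\ge1$. For a real function $f$, $\mathrm{epi}(f)=\{(x,y)\in\mathrm{Dom}(f)\times\mathbb R: y>f(x)\}$ and $\mathrm{hypo}(f)=\{(x,y)\in\mathrm{Dom}(f)\times\mathbb R: y<f(x)\}$. The subsets $D_k^{(n)}\subset\mathrm{Dom}(\Phi_n)$, $0\le k\le n$, are defined inductively, with $\Gamma_k^{(n)}\subset\mathbb R^{n+1}$ the graph of $\Phi_n|_{D_k^{(n)}}$. Convention for $n=0$: $D_0^{(0)}=\mathbb R^0$ is a point, $\Phi_0=-1$, $\Gamma_0^{(0)}=\{-1\}\subset\mathbb R$. For $n=1$: $D_0^{(1)}=(-1,\infty)$, $D_1^{(1)}=(-\infty,-1)$. For $n\ge1$: $D_0^{(n+1)}=\mathrm{epi}(\Phi_n|_{D_0^{(n)}})$, $D_{n+1}^{(n+1)}=\mathrm{hypo}(\Phi_n|_{D_n^{(n)}})$, and for $1\le k\le n$, $D_k^{(n+1)}=\mathrm{hypo}(\Phi_n|_{D_{k-1}^{(n)}})\cup(\Gamma_{k-1}^{(n-1)}\times\mathbb R)\cup\mathrm{epi}(\Phi_n|_{D_k^{(n)}})$. (These are the $n+1$ connected components of $\mathrm{Dom}(\Phi_n)$.) *)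

(* Defs.v *)
From HB Require Import structures.
From mathcomp Require Import all_boot all_order all_algebra.
From mathcomp Require Import complex.
From mathcomp Require Import all_classical all_reals all_analysis.

Set Implicit Arguments.
Unset Strict Implicit.
Unset Printing Implicit Defensive.

Import Order.TTheory GRing.Theory Num.Theory.
Import numFieldNormedType.Exports.

Local Open Scope classical_set_scope.
Local Open Scope complex_scope.
Local Open Scope ring_scope.

Section HilbertSpace.
Variable R : realType.

(* The space l^2(N) is the set [l2] of square-summable complex sequences.
   Sequences are indexed from 0: the k-th term here is the (k+1)-st one when
   N = {1, 2, ...}. *)
Definition cseq := nat -> R[i].

Definition l2 : set cseq :=
  [set x | (\sum_(0 <= k <oo) ((Normc.normc (x k)) ^+ 2)%:E < +oo)%E].

(* <x, y> = sum_k x_k conj(y_k), summed separately on real and imaginary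
   parts; both series converge absolutely when x and y are in l^2. *)
Definition inner (x y : cseq) : R[i] :=
  limn (series (fun k => complex.Re (x k * (y k)^*)))
  +i* limn (series (fun k => complex.Im (x k * (y k)^*))).

Definition basis_vec (j : nat) : cseq := fun k => (k == j)%:R.

(* Operators are functions on all sequences, of which only the restriction to
   [l2] is relevant below (except for solutions in the entrywise sense). *)
Definition operator := cseq -> cseq.

Definition orthogonal_projection (P : operator) : Prop :=
  [/\ (forall x, l2 x -> l2 (P x)),
      (forall (a : R[i]) x y, l2 x -> l2 y ->
         P (fun k => a * x k + y k) = (fun k => a * P x k + P y k)),
      (forall x, l2 x -> P (P x) = P x) &
      (forall x y, l2 x -> l2 y -> inner (P x) y = inner x (P y))].

(* E is the spectral measure of the (everywhere defined on l^2) self-adjoint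
   operator A: E is projection-valued on Borel sets, E(R) = 1, every
   B |-> <E(B) x, x> is a measure, and A = \int t dE(t).  The second moment of
   <E(.) x, x> is required to be finite for all x because the domain of
   \int t dE(t) is { x | \int t^2 d<E(t) x, x> < +oo }.  By the spectral
   theorem such an E exists, and it is unique on l^2. *)
Definition spectral_measure (A : operator) (E : set R -> operator) : Prop :=
  [/\ (forall B : set (measurableTypeR R), measurable B ->
         orthogonal_projection (E B)),
      (forall x, l2 x -> E setT x = x) &
      (forall x, l2 x ->
         exists m : {measure set (measurableTypeR R) -> \bar R},
         [/\ (forall B, measurable B -> m B = (complex.Re (inner (E B x) x))%:E),
             m.-integrable setT (fun t => (t ^+ 2)%:E) &
             inner (A x) x = (Rintegral m setT (fun t => t))%:C])].

(* Trace of a nonnegative operator, with values in [0, +oo]. *)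
Definition trace (P : operator) : \bar R :=
  (\sum_(0 <= k <oo)
     (complex.Re (inner (P (basis_vec k)) (basis_vec k)))%:E)%E.

Definition l2_eigenspace (A : operator) (lam : R[i]) : set cseq :=
  [set psi | l2 psi /\ A psi = (fun k => lam * psi k)].

Definition l2_eigenvalue (A : operator) (lam : R[i]) : Prop :=
  exists2 psi, l2_eigenspace A lam psi & psi <> (fun=> 0).

Definition simple_eigenvalue (A : operator) (lam : R[i]) : Prop :=
  exists psi, [/\ l2_eigenspace A lam psi, psi <> (fun=> 0) &
    forall phi, l2_eigenspace A lam phi -> exists c, phi = (fun k => c * psi k)].

Definition exactly_simple_negative_eigenvalues (A : operator) (k : nat) : Prop :=
  ([set lam : R | lam < 0 /\ l2_eigenvalue A lam%:C] #= `I_k)%card /\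
  (forall lam : R, lam < 0 -> l2_eigenvalue A lam%:C -> simple_eigenvalue A lam%:C).

Definition threshold_resonance (A : operator) : Prop :=
  exists Psi : cseq,
    [/\ Psi <> (fun=> 0),
        (exists M : R, forall k, Normc.normc (Psi k) <= M) &
        A Psi = (fun=> 0)].

End HilbertSpace.

Section JacobiOperators.
Variable R : realType.

(* (mu_1, ..., mu_n, 0, 0, ...): [entry mu k] is mu_(k+1). *)
Definition entry n (mu : 'rV[R]_n) (k : nat) : R :=
  if insub k is Some i then mu ord0 i else 0.

(* Off-diagonal entries: [offdiag k] is a_(k+1). *)
Definition offdiag (k : nat) : R := if k == 0%N then - Num.sqrt 2 else -1.

Definition free_jacobi : operator R := fun psi k =>
  (if k is j.+1 then (offdiag j)%:C * psi j else 0)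
  + 2 * psi k + (offdiag k)%:C * psi k.+1.

Definition potential n (mu : 'rV[R]_n) : operator R := fun psi k =>
  (if k == 0%N then 2 * entry mu 0 else entry mu k)%:C * psi k.

Definition H_op n (mu : 'rV[R]_n) : operator R := fun psi k =>
  free_jacobi psi k + potential mu psi k.

(* [H_op mu] is critical at its left threshold 0.  The family E of spectral
   measures is unique (see [spectral_measure]), so the existential quantifier
   only names it. *)
Definition virtual_level n (mu : 'rV[R]_n) : Prop :=
  exists E : 'rV[R]_n -> set R -> operator R,
    (forall nu, spectral_measure (H_op nu) (E nu)) /\
    ~ {for mu, continuous (fun nu => trace (E nu `]-oo, 0[%classic))}.

End JacobiOperators.

Section Components.
Variable R : realType.

Fixpoint Qseq (m : nat -> R) (n : nat) : R :=
  match n with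
  | 0 => 1
  | p.+1 => match p with
            | 0 => 1 + m 0
            | q.+1 => (2 + m p) * Qseq m p - Qseq m q
            end
  end.

Definition Q (n : nat) d (mu : 'rV[R]_d) : R := Qseq (entry mu) n.

(* [Phi 0] is the convention Phi_0 = -1.  For n >= 1 this is only meaningful
   where Q_n <> 0, hence on the sets [D n k] below. *)
Definition Phi (n : nat) (mu : 'rV[R]_n) : R :=
  if n is p.+1 then Q p mu / Q n mu - 2 else -1.

(* A point of R^(n+1) is the pair (pt_init, pt_last) of R^n x R. *)
Definition pt_init n (z : 'rV[R]_n.+1) : 'rV[R]_n :=
  \row_(i < n) z ord0 (widen_ord (leqnSn n) i).

Definition pt_last n (z : 'rV[R]_n.+1) : R := z ord0 ord_max.

(* Graph, epigraph and hypograph of f restricted to A. *)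
Definition graph n (f : 'rV[R]_n -> R) (A : set 'rV[R]_n) : set 'rV[R]_n.+1 :=
  [set z | A (pt_init z) /\ pt_last z = f (pt_init z)].

Definition epi n (f : 'rV[R]_n -> R) (A : set 'rV[R]_n) : set 'rV[R]_n.+1 :=
  [set z | A (pt_init z) /\ f (pt_init z) < pt_last z].

Definition hypo n (f : 'rV[R]_n -> R) (A : set 'rV[R]_n) : set 'rV[R]_n.+1 :=
  [set z | A (pt_init z) /\ pt_last z < f (pt_init z)].

Definition D_0 (k : nat) : set 'rV[R]_0 := if k == 0%N then setT else set0.

Definition D_1 (k : nat) : set 'rV[R]_1 :=
  match k with
  | 0 => [set z : 'rV[R]_1 | -1 < z ord0 ord0]
  | 1 => [set z : 'rV[R]_1 | z ord0 ord0 < -1]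
  | _ => set0
  end.

(* The family at dimension n.+2 from those at dimensions n and n.+1; it is
   empty for indices k > n.+2. *)
Definition D_step n (DA : nat -> set 'rV[R]_n) (DB : nat -> set 'rV[R]_n.+1)
    (k : nat) : set 'rV[R]_n.+2 :=
  if k is j.+1 then
    if (k <= n.+1)%N then
      hypo (@Phi n.+1) (DB j)
      `|` [set z : 'rV[R]_n.+2 | graph (@Phi n) (DA j) (pt_init z)]
      `|` epi (@Phi n.+1) (DB k)
    else if k == n.+2 then hypo (@Phi n.+1) (DB n.+1)
    else set0
  else epi (@Phi n.+1) (DB 0%N).

Fixpoint D_pair (n : nat) :
    (nat -> set 'rV[R]_n) * (nat -> set 'rV[R]_n.+1) :=
  match n with
  | 0 => (D_0, D_1)
  | p.+1 => ((D_pair p).2, D_step (D_pair p).1 (D_pair p).2)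
  end.

(* [D n k] is D_k^(n). *)
Definition D (n k : nat) : set 'rV[R]_n := (D_pair n).1 k.

End Components.

Arguments D {R} n k _.

(* Main.v *)
Require Import Defs.
From HB Require Import structures.
From mathcomp Require Import all_boot all_order all_algebra.
From mathcomp Require Import complex ring lra.
From mathcomp Require Import all_classical all_reals all_analysis.
From mathcomp Require Import measurable_realfun.

Set Implicit Arguments.
Unset Strict Implicit.
Unset Printing Implicit Defensive.

Import Order.TTheory GRing.Theory Num.Theory.
Import numFieldNormedType.Exports.

Local Open Scope classical_set_scope.
Local Open Scope complex_scope.
Local Open Scope ring_scope.

(* After rescaling the first coordinate, the quadratic form of H_mu splits as
     <H x, x> = J(x_1, ..., x_n) + sum_(k >= n) |x_k - x_(k+1)|^2,
   where J is the form of the n x n Jacobi matrix with off-diagonal entries -1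
   and last diagonal entry lowered by 1; its determinant is Q_n - Q_(n-1).  The
   tail is nonnegative and can be made arbitrarily small, so the rank of
   E((-oo, 0)) is the negative index of J (the min-max principle).  If
   Q_n <> Q_(n-1) then J is nondegenerate, its negative index is locally
   constant, and mu is not critical.  If Q_n = Q_(n-1), the zero energy solution
   is constant from index n on, which is the resonance, and mu lies over a point
   with Q_(n-1) <> 0; completing squares one variable at a time follows the
   recursion for the D_k^(n): passing to an epigraph (hypograph) adds a
   positive (negative) square, and a zero of Q_j gives a hyperbolic 2 x 2 block.
   Finally, ran E((-oo, 0)) is finite-dimensional and H_mu-invariant, hence has an
   orthonormal basis of eigenvectors, and eigenspaces of a Jacobi operator are at
   most one-dimensional. *)

(** [spectral_measure] provides projections and the scalar measures <E(B) x, x> only, so neither a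
    product rule for E nor its commutation with H_mu can be quoted. With P = E((-oo, 0)), invariance
    of ran P is extracted from the quadratic form: polarizing its additivity on ran P + ker P gives
    <H x, y> = 0 for x in ran P and y in ker P, so H x has no component in ker P. Ranks are compared
    without dimension theory on l^2: N functionals on whose common kernel the form is nonnegative
    bound the rank from above, a linear map of C^N into l^2 on which the form is negative bounds it
    from below. A diagonalization of J supplies both, its coordinates being the functionals. It also
    carries a norm bound, which makes the count stable under small changes of mu and leaves room for
    the energy of a linear cut-off of the trial vectors. The uniqueness of k does not come from
    disjointness of the D_k^(n): k is the number of negative eigenvalues, which depends on mu
    alone. *)

Section ComplexParts.
Variable R : realType.
Implicit Types z w : R[i].

Lemma ReD z w : complex.Re (z + w) = complex.Re z + complex.Re w.
Proof. by case: z w => [? ?] [? ?]. Qed.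

Lemma ImD z w : complex.Im (z + w) = complex.Im z + complex.Im w.
Proof. by case: z w => [? ?] [? ?]. Qed.

Lemma ReN z : complex.Re (- z) = - complex.Re z.
Proof. by case: z. Qed.

Lemma ImN z : complex.Im (- z) = - complex.Im z.
Proof. by case: z. Qed.

Lemma ReM z w :
  complex.Re (z * w) = complex.Re z * complex.Re w - complex.Im z * complex.Im w.
Proof. by case: z w => [? ?] [? ?]. Qed.

Lemma ImM z w :
  complex.Im (z * w) = complex.Re z * complex.Im w + complex.Im z * complex.Re w.
Proof. by case: z w => [? ?] [? ?]. Qed.

Lemma ReJ z : complex.Re (z^*) = complex.Re z.
Proof. by case: z. Qed.

Lemma ImJ z : complex.Im (z^*) = - complex.Im z.
Proof. by case: z. Qed.

Definition partsE := (ReD, ImD, ReN, ImN, ReM, ImM, ReJ, ImJ).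

Lemma complex_ext z w :
  complex.Re z = complex.Re w -> complex.Im z = complex.Im w -> z = w.
Proof. by case: z w => [? ?] [? ?] /= -> ->. Qed.

(** The real inner product Re (z conj w) of C as a real plane. All forms below are written with it,
    so that estimates are inequalities between reals. *)
Definition redot z w : R :=
  complex.Re z * complex.Re w + complex.Im z * complex.Im w.

Lemma redot_ge0 z : 0 <= redot z z.
Proof. by rewrite /redot -!expr2 addr_ge0 ?sqr_ge0. Qed.

Lemma redot_eq0 z : redot z z = 0 -> z = 0.
Proof.
move=> /eqP; rewrite /redot -!expr2 paddr_eq0 ?sqr_ge0 // !sqrf_eq0.
by case/andP=> /eqP h1 /eqP h2; apply: complex_ext.
Qed.

Lemma redot_gt0 z : z != 0 -> 0 < redot z z.
Proof.
by rewrite lt_neqAle redot_ge0 andbT => h; apply: contra_neq h => /esym/redot_eq0.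
Qed.

Lemma redot_le z w : `|redot z w| <= redot z z + redot w w.
Proof.
rewrite ler_norml /redot.
have := sqr_ge0 (complex.Re z + complex.Re w).
have := sqr_ge0 (complex.Re z - complex.Re w).
have := sqr_ge0 (complex.Im z + complex.Im w).
have := sqr_ge0 (complex.Im z - complex.Im w).
have := sqr_ge0 (complex.Re z); have := sqr_ge0 (complex.Re w).
have := sqr_ge0 (complex.Im z); have := sqr_ge0 (complex.Im w).
move=> h1 h2 h3 h4 h5 h6 h7 h8; apply/andP; split; nra.
Qed.

Lemma redot_add_le z w : redot (z + w) (z + w) <= 2 * redot z z + 2 * redot w w.
Proof.
rewrite /redot !partsE.
have := sqr_ge0 (complex.Re z - complex.Re w).
have := sqr_ge0 (complex.Im z - complex.Im w).
by move=> h1 h2; nra.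
Qed.

Lemma redotM z w : redot (z * w) (z * w) = redot z z * redot w w.
Proof. by rewrite /redot !partsE; ring. Qed.

End ComplexParts.

(** * Linear combinations of sequences and dimension counting *)

Section LinearCombinations.
Variable R : realType.
Local Notation C := R[i].
Implicit Types (x y : cseq R) (V : set (cseq R)).

Definition axpy (a : C) x y : cseq R := fun k => a * x k + y k.

Definition lcomb (M : nat) (c : nat -> C) (u : nat -> cseq R) : cseq R :=
  fun k => \sum_(i < M) c i * u i k.

Definition linear_subspace V :=
  V (fun=> 0) /\ forall a x y, V x -> V y -> V (axpy a x y).

Definition functional_on V (f : cseq R -> C) :=
  forall a x y, V x -> V y -> f (axpy a x y) = a * f x + f y.

Definition linear_op (T : operator R) :=
  forall a x y, T (axpy a x y) = axpy a (T x) (T y).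

Definition scale (a : C) x : cseq R := fun k => a * x k.

Lemma axpy0 a x : axpy a x (fun=> 0) = scale a x.
Proof. by apply/funext => k; rewrite /axpy addr0. Qed.

Lemma scale0 a : scale a (fun=> 0) = (fun=> 0).
Proof. by apply/funext => k; rewrite /scale mulr0. Qed.

Lemma axpyN1 x : axpy (-1) x x = (fun=> 0).
Proof. by apply/funext => k; rewrite /axpy mulN1r addNr. Qed.

Lemma axpyN1_eq0 x y : axpy (-1) x y = (fun=> 0) -> y = x.
Proof.
move=> h; apply/funext => k; have := congr1 (fun f => f k) h.
by rewrite /axpy mulN1r addrC => /eqP; rewrite subr_eq0 => /eqP.
Qed.

Lemma linear_op0 T : linear_op T -> T (fun=> 0) = fun=> 0.
Proof. by move=> /(_ (-1) (fun=> 0) (fun=> 0)); rewrite axpy0 scale0 axpyN1. Qed.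

Lemma lcombS M c u : lcomb M.+1 c u = axpy (c M) (u M) (lcomb M c u).
Proof. by apply/funext => k; rewrite /lcomb big_ord_recr /= /axpy addrC. Qed.

Lemma lcomb0 c u : lcomb 0 c u = fun=> 0.
Proof. by apply/funext => k; rewrite /lcomb big_ord0. Qed.

Lemma linear_subspace_lcomb V M c u : linear_subspace V ->
  (forall i, (i < M)%N -> V (u i)) -> V (lcomb M c u).
Proof.
move=> [V0 Vl]; elim: M => [|M IH] hu; first by rewrite lcomb0.
rewrite lcombS; apply: Vl; first exact: hu.
by apply: IH => i hi; apply: hu; rewrite ltnW.
Qed.

Lemma functional_on0 V f : linear_subspace V -> functional_on V f -> f (fun=> 0) = 0.
Proof.
move=> [V0 Vl] fl.
by have := fl (- 1) _ _ V0 V0; rewrite axpyN1 mulN1r addNr.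
Qed.

Lemma functional_on_lcomb V f M c u : linear_subspace V -> functional_on V f ->
  (forall i, (i < M)%N -> V (u i)) ->
  f (lcomb M c u) = \sum_(i < M) c i * f (u i).
Proof.
move=> sV fl; elim: M => [|M IH] hu.
  by rewrite lcomb0 big_ord0 (functional_on0 sV fl).
have hu' i : (i < M)%N -> V (u i) by move=> hi; apply: hu; rewrite ltnW.
rewrite lcombS fl; [|exact: hu|exact: linear_subspace_lcomb].
by rewrite IH // big_ord_recr /= addrC.
Qed.

Lemma linear_subspaceT : linear_subspace setT.
Proof. by []. Qed.

Lemma lcomb_basis M c k :
  lcomb M c (fun i => basis_vec R i) k = if (k < M)%N then c k else 0.
Proof.
rewrite /lcomb /basis_vec; case: ltnP => hk.
  rewrite (bigD1 (Ordinal hk)) //= eqxx mulr1 big1 ?addr0 // => i hi.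
  suff -> : (k == i :> nat) = false by rewrite mulr0.
  by apply/negbTE; apply: contraNneq hi => e; apply/eqP/val_inj.
rewrite big1 // => i _.
suff -> : (k == i :> nat) = false by rewrite mulr0.
by apply/negbTE; rewrite neq_ltn (leq_trans (ltn_ord i) hk) orbT.
Qed.

(** The M x N matrix of the f_j(u_i), N < M, has a nonzero row vector in its left kernel. This one
    dimension count yields annihilating polynomials as well as both bounds on the rank of P. *)
Lemma lcomb_kernel V M N (f : nat -> cseq R -> C) (u : nat -> cseq R) :
  linear_subspace V -> (forall j, (j < N)%N -> functional_on V (f j)) ->
  (forall i, (i < M)%N -> V (u i)) -> (N < M)%N ->
  exists c : nat -> C, (exists2 i, (i < M)%N & c i != 0) /\
    forall j, (j < N)%N -> f j (lcomb M c u) = 0.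
Proof.
move=> sV fl hu NM.
pose A : 'M[C]_(M, N) := \matrix_(i, j) f j (u i).
have : kermx A != 0.
  rewrite -mxrank_eq0 mxrank_ker -lt0n subn_gt0.
  by rewrite (leq_ltn_trans (rank_leq_col A)).
case/rowV0Pn => v /sub_kermxP vA v0.
pose c k := if insub k is Some i then v ord0 i else 0.
have cE (i : 'I_M) : c i = v ord0 i by rewrite /c valK.
exists c; split.
  have [i hi] : exists i, v ord0 i != 0.
    apply/existsP; apply: contraNT v0 => /existsPn h.
    by apply/eqP/rowP => i; rewrite mxE; apply/eqP; rewrite -[_ == _]negbK h.
  by exists i; rewrite ?cE.
move=> j hj; rewrite (functional_on_lcomb _ sV (fl j hj)) //.
have := congr1 (fun B : 'rV_N => B ord0 (Ordinal hj)) vA; rewrite !mxE => e.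
by rewrite -[RHS]e; apply: eq_bigr => i _; rewrite cE mxE.
Qed.

End LinearCombinations.

(** * Diagonalization of Jacobi forms *)

Section JacobiForms.
Variable R : realType.
Local Notation C := R[i].
Implicit Types (d s : nat -> R) (x y : cseq R).

(* The n-th leading principal minor of the Jacobi matrix with diagonal d and
   off-diagonal entries -1. *)
Fixpoint cont d n : R :=
  if n is p.+1 then d p * cont d p - (if p is q.+1 then cont d q else 0) else 1.

Definition pcont d n : R := if n is p.+1 then cont d p else 0.

Definition pred_term x k : C := if k is j.+1 then x j else 0.

Definition Jform d n x : R :=
  \sum_(k < n) (d k * redot (x k) (x k) - 2 * redot (pred_term x k) (x k)).

Lemma cont0 d : cont d 0 = 1. Proof. by []. Qed.

Lemma contS d n : cont d n.+1 = d n * cont d n - pcont d n.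
Proof. by []. Qed.

Arguments cont : simpl never.

Lemma eq_cont d d' n : (forall k, (k < n)%N -> d k = d' k) ->
  cont d n = cont d' n.
Proof.
elim/ltn_ind: n => [[|n]] IH h //; rewrite !contS h //.
rewrite IH // => [|k hk]; last by rewrite h // ltnW.
congr (_ - _); case: n IH h => //= n IH h.
by apply: IH => // k hk; rewrite h // ltnW // ltnW.
Qed.

Lemma eq_Jform d d' n x y : (forall k, (k < n)%N -> d k = d' k) ->
  (forall k, (k < n)%N -> x k = y k) -> Jform d n x = Jform d' n y.
Proof.
move=> h1 h2; apply: eq_bigr => -[k hk] _ /=; rewrite h1 // h2 //.
by case: k hk => //= k hk; rewrite h2 // ltnW.
Qed.

Lemma JformS d n x : Jform d n.+1 x =
  Jform d n x + (d n * redot (x n) (x n) - 2 * redot (pred_term x n) (x n)).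
Proof. by rewrite /Jform big_ord_recr. Qed.

(* The vector of principal minors solves the Jacobi equation in all rows but
   the last one, so that the cross terms telescope. *)
Lemma Jform_sub_cont d n (t : C) x :
  Jform d n (fun k => x k - t * (cont d k)%:C) =
  Jform d n x - 2 * redot (pred_term x n) t * cont d n
    + redot t t * (pcont d n * cont d n).
Proof.
elim: n => [|n IH].
  by rewrite /Jform !big_ord0 /redot /=; ring.
rewrite !JformS IH contS /redot /= !partsE /=.
case: n {IH} => [|n]; rewrite /= ?partsE /=; ring.
Qed.

(** Gaussian elimination: the pivot is a ratio of consecutive minors, and the vector subtracted is
    that of the minors, scaled by x_n / [cont d n]. *)
Lemma Jform_complete_square d n x : cont d n != 0 ->
  Jform d n.+1 x =
  Jform d n (fun k => x k - x n * (cont d k / cont d n)%:C)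
    + cont d n.+1 / cont d n * redot (x n) (x n).
Proof.
move=> h.
pose t : C := x n * ((cont d n)^-1)%:C.
have -> : (fun k => x k - x n * (cont d k / cont d n)%:C)
        = (fun k => x k - t * (cont d k)%:C).
  by apply/funext => k; apply: complex_ext; rewrite /t !partsE /=; ring.
rewrite Jform_sub_cont JformS contS /t /redot !partsE /=; field; exact: h.
Qed.

(** [T] passes to diagonalizing coordinates and fixes every coordinate from [n] on, so that steps
    can be chained. [Ti] is a right inverse because vectors are later built from prescribed diagonal
    coordinates. [diag_bound] controls the old coordinates by the new ones, which is what bounds the
    effect of a perturbation of the form. *)
Record diagonalizes n (q : cseq R -> R) s (T Ti : operator R) (c : R) : Prop :=
  Diagonalizes {
    diag_lin : linear_op T;
    diag_ilin : linear_op Ti;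
    diag_inv : forall y, T (Ti y) = y;
    diag_id : forall x j, (n <= j)%N -> T x j = x j;
    diag_form : forall x, q x = \sum_(i < n) s i * redot (T x i) (T x i);
    diag_c : 0 <= c;
    diag_bound : forall x, \sum_(i < n) redot (x i) (x i) <=
      c * \sum_(i < n) redot (T x i) (T x i) }.

Definition has_diagonal_form n q s := exists T Ti c, diagonalizes n q s T Ti c.

Lemma eq_diagonal_form n q q' s s' : (forall x, q x = q' x) ->
  (forall i, (i < n)%N -> s i = s' i) ->
  has_diagonal_form n q s -> has_diagonal_form n q' s'.
Proof.
move=> hq hs [T [Ti [c [h1 h2 h3 h4 h5 h6 h7]]]]; exists T, Ti, c; split => // x.
by rewrite -hq h5; apply: eq_bigr => -[i hi] _ /=; rewrite hs.
Qed.

Lemma diagonal_form0 d s : has_diagonal_form 0 (Jform d 0) s.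
Proof.
exists id, id, 0; split => // x; first by rewrite /Jform !big_ord0.
by rewrite !big_ord0 mulr0.
Qed.

Definition snoc s n (a : R) : nat -> R := fun i => if i == n then a else s i.

Lemma snoc_last s n a : snoc s n a n = a.
Proof. by rewrite /snoc eqxx. Qed.

Lemma snoc_lt s n a i : (i < n)%N -> snoc s n a i = s i.
Proof. by rewrite /snoc => h; rewrite (ltn_eqF h). Qed.

(** Cut off at [n], so that subtracting a multiple of it leaves [x n] and all later coordinates
    alone. *)
Definition elim_vec d n : cseq R :=
  fun k => if (k < n)%N then (cont d k / cont d n)%:C else 0.

Lemma linear_eliml n (v : cseq R) (a : C) :
  linear_op (fun x => axpy (a * x n) v x).
Proof. by move=> b x y; apply/funext => k; rewrite /axpy; ring. Qed.

Lemma redot_sub_bound (n : nat) (x v : cseq R) (b : C) :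
  \sum_(i < n) redot (x i) (x i) <=
  2 * \sum_(i < n) redot (axpy b v x i) (axpy b v x i) +
  2 * redot b b * \sum_(i < n) redot (v i) (v i).
Proof.
rewrite 2!mulr_sumr -big_split /=; apply: ler_sum => i _.
have := redot_add_le (axpy b v x i) (- (b * v i)).
rewrite {1 2}/axpy addrAC subrr add0r => /le_trans; apply.
rewrite lerD2l -mulrA -redotM le_eqVlt; apply/orP; left; apply/eqP.
by rewrite /redot !partsE; ring.
Qed.

(** The clause [T x n = x n] serves the hyperbolic step, which couples this coordinate to the next
    one. *)
Lemma diagonalizes_step d n s : cont d n != 0 ->
  has_diagonal_form n (Jform d n) s ->
  exists T Ti c, diagonalizes n.+1 (Jform d n.+1)
      (snoc s n (cont d n.+1 / cont d n)) T Ti c /\ forall x, T x n = x n.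
Proof.
move=> h0 [T [Ti [c [Tl Til TTi Tid Tf c0 Tb]]]].
set v := elim_vec d n; have vn : v n = 0 by rewrite /v /elim_vec ltnn.
pose E b x := axpy (b * x n) v x.
have El b : linear_op (E b) by exact: linear_eliml.
have En b x : E b x n = x n by rewrite /E /axpy vn mulr0 add0r.
have Tin y : Ti y n = y n by rewrite -[in RHS](TTi y) Tid.
pose V2 := \sum_(i < n) redot (v i) (v i).
have V20 : 0 <= V2 by apply: sumr_ge0 => i _; exact: redot_ge0.
(* 2 c and 2 V2 come from |a + b|^2 <= 2 |a|^2 + 2 |b|^2 applied to the elimination; the 1 pays for
   coordinate n itself. *)
exists (fun x => T (E (-1) x)), (fun y => E 1 (Ti y)), (2 * c + 2 * V2 + 1).
split; last by move=> x; rewrite Tid // En.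
split => //.
- by move=> a x y; rewrite El Tl.
- by move=> a x y; rewrite Til El.
- move=> y; rewrite -[RHS]TTi; congr T; apply/funext => k.
  by rewrite {1}/E /axpy En /E /axpy; ring.
- move=> x j hj; rewrite Tid ?(ltnW hj) // /E /axpy /v /elim_vec.
  by rewrite ltnNge (ltnW hj) /= mulr0 add0r.
- move=> x; rewrite Jform_complete_square // big_ord_recr /= snoc_last.
  rewrite Tid // En; congr (_ + _).
  have -> : \sum_(i < n) snoc s n (cont d n.+1 / cont d n) i *
      redot (T (E (-1) x) i) (T (E (-1) x) i) = Jform d n (E (-1) x).
    by rewrite Tf; apply: eq_bigr => i _; rewrite snoc_lt.
  apply: eq_Jform => // k hk; rewrite /E /axpy /v /elim_vec hk; ring.
- by rewrite !addr_ge0 // mulr_ge0.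
- move=> x; rewrite !big_ord_recr /= Tid // En.
  have h1 := redot_sub_bound n x v (-1 * x n); rewrite -/(E (-1) x) -/V2 in h1.
  have h2 := Tb (E (-1) x).
  have e : redot (-1 * x n) (-1 * x n) = redot (x n) (x n).
    by rewrite /redot !partsE /=; ring.
  rewrite e in h1.
  have h3 := redot_ge0 (x n).
  set S := \sum_(i < n) redot (T _ i) _ in h2 *.
  have S0 : 0 <= S by apply: sumr_ge0 => i _; exact: redot_ge0.
  set A := \sum_(i < n) redot (x i) _ in h1 *.
  set B := \sum_(i < n) _ in h1 h2 *.
  set r := redot (x n) _ in h1 h3 *.
  have := mulr_ge0 V20 S0; have := mulr_ge0 c0 h3 => h4 h5.
  by nra.
Qed.

End JacobiForms.

Arguments cont : simpl never.

(** * Signs of the diagonal coefficients *)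

Section JacobiInertia.
Variable R : realType.
Local Notation C := R[i].
Implicit Types (d s : nat -> R) (x y : cseq R).

Lemma diagonal_form_step d n s : cont d n != 0 ->
  has_diagonal_form n (Jform d n) s ->
  has_diagonal_form n.+1 (Jform d n.+1) (snoc s n (cont d n.+1 / cont d n)).
Proof.
by move=> h0 /(diagonalizes_step h0)[T [Ti [c []]]]; exists T, Ti, c.
Qed.

(* The 2x2 block [[0,-1],[-1,2e]] becomes diag(-1/2,1/2) in the coordinates
   p - e q + q, p - e q - q. *)
Definition hyp_split n (e : C) (z : cseq R) : cseq R := fun k =>
  if k == n then z n - e * z n.+1 + z n.+1
  else if k == n.+1 then z n - e * z n.+1 - z n.+1 else z k.

Definition hyp_merge n (e : C) (z : cseq R) : cseq R := fun k =>
  if k == n then (z n + z n.+1) / 2 + e * ((z n - z n.+1) / 2)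
  else if k == n.+1 then (z n - z n.+1) / 2 else z k.

Lemma hyp_mergeK n e z : hyp_split n e (hyp_merge n e z) = z.
Proof.
have n2 : (n.+1 == n) = false by rewrite gtn_eqF.
apply/funext => k; rewrite /hyp_split /hyp_merge !eqxx n2.
case: eqP => [->|_]; last case: eqP => [->|_] //; by field.
Qed.

Lemma redot_half (z : C) : redot (z / 2) (z / 2) = redot z z / 4.
Proof.
have -> : z / 2 = z * (2^-1 : R)%:C.
  by congr (_ * _); rewrite -[2 in LHS](rmorph_nat (real_complex R)) -fmorphV.
by rewrite /redot !partsE /=; field.
Qed.

Lemma hyp_merge_bound n e z :
  redot (hyp_merge n e z n) (hyp_merge n e z n) +
  redot (hyp_merge n e z n.+1) (hyp_merge n e z n.+1) <=
  (redot e e + 2) * (redot (z n) (z n) + redot (z n.+1) (z n.+1)).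
Proof.
have n2 : (n.+1 == n) = false by rewrite gtn_eqF.
rewrite /hyp_merge !eqxx n2.
apply: le_trans (lerD (redot_add_le _ _) (lexx _)) _.
rewrite redot_half redotM !redot_half.
have h1 := redot_add_le (z n) (z n.+1).
have := redot_add_le (z n) (- z n.+1).
have -> : redot (- z n.+1) (- z n.+1) = redot (z n.+1) (z n.+1).
  by rewrite /redot !partsE; ring.
have h0 := redot_ge0 e; have h3 := redot_ge0 (z n).
have h4 := redot_ge0 (z n.+1).
set A := redot (z n - _) _; set B := redot (z n + _) _ in h1 *.
set a := redot (z n) _ in h1 h3 *; set b := redot (z n.+1) _ in h1 h4 *.
move=> h2.
have := ler_wpM2l h0 h2; have := mulr_ge0 h0 h3; have := mulr_ge0 h0 h4.
by move=> *; nra.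
Qed.

(** As [cont d n.+1] = 0, the pivot of coordinate n vanishes and this coordinate survives only in
    its cross term with n + 1; [hyp_split] treats the two together. *)
Lemma diagonal_form_hyp_step d n s : cont d n != 0 -> cont d n.+1 = 0 ->
  has_diagonal_form n (Jform d n) s ->
  has_diagonal_form n.+2 (Jform d n.+2) (snoc (snoc s n (- 2^-1)) n.+1 (2^-1)).
Proof.
move=> h0 h1 /(diagonalizes_step h0)[T [Ti [c [[Tl Til TTi Tid Tf c0 Tb] Tn]]]].
rewrite h1 mul0r in Tf.
pose e : C := (d n.+1 / 2)%:C; pose c' := redot e e + 2.
have n2 : (n.+1 == n) = false by rewrite gtn_eqF.
have c'1 : 2 <= c' by rewrite /c' lerDr redot_ge0.
exists (fun x => hyp_split n e (T x)), (fun y => Ti (hyp_merge n e y)).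
(* [c'] bounds [hyp_merge] on the block; in [c + 1] the 1 is for coordinate n + 1, which the bound
   for [T] does not cover. *)
exists ((c + 1) * c'); split.
- move=> a x y; rewrite Tl; apply/funext => k; rewrite /hyp_split /axpy.
  by case: eqP => _; last case: eqP => _ //; ring.
- move=> a x y; rewrite -Til; congr Ti; apply/funext => k.
  by rewrite /hyp_merge /axpy; case: eqP => _; last case: eqP => _ //; ring.
- by move=> y; rewrite TTi hyp_mergeK.
- move=> x j hj; rewrite /hyp_split gtn_eqF 1?ltnW // gtn_eqF //.
  by rewrite Tid // ltnW.
- move=> x; rewrite JformS Tf !big_ord_recr /= -addrA -addrA.
  congr (_ + _).
    apply: eq_bigr => -[i hi] _ /=; rewrite /hyp_split /snoc.
    by rewrite !ltn_eqF // ltnW.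
  rewrite /hyp_split /snoc !eqxx n2 ltn_eqF // Tn Tid //.
  by rewrite /redot !partsE /e /=; field.
- by apply: mulr_ge0; [rewrite addr_ge0|apply: le_trans c'1].
- move=> x.
  have := hyp_merge_bound n e (hyp_split n e (T x)); rewrite -/c'.
  have -> : hyp_merge n e (hyp_split n e (T x)) = T x.
    apply/funext => k; rewrite /hyp_split /hyp_merge !eqxx n2.
    by case: eqP => [->|_]; last case: eqP => [->|_] //; field.
  have := Tb x; rewrite !big_ord_recr /= -addrA Tn (Tid _ n.+1) //.
  have -> : \sum_(i < n) redot (hyp_split n e (T x) i) (hyp_split n e (T x) i)
          = \sum_(i < n) redot (T x i) (T x i).
    apply: eq_bigr => -[i hi] _ /=; rewrite /hyp_split /snoc.
    by rewrite !ltn_eqF // ltnW.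
  set S := \sum_(i < n) redot (T x i) _.
  have S0 : 0 <= S by apply: sumr_ge0 => i _; exact: redot_ge0.
  set A := \sum_(i < n) redot (x i) _.
  have := redot_ge0 (x n); have := redot_ge0 (x n.+1).
  set p := redot (x n) _; set q := redot (x n.+1) _.
  set u := redot _ _; set v := redot _ _ => q0 p0 b1 b2.
  have := ler_wpM2l c0 b2.
  have := mulr_ge0 c0 S0.
  have := mulr_ge0 c0 q0.
  have : (c + 1) * S * 2 <= (c + 1) * S * c'.
    by apply: ler_wpM2l => //; rewrite mulr_ge0 // addr_ge0.
  by move=> *; nra.
Qed.

(** A vanishing minor is passed over in a 2 x 2 block. The minor before it is nonzero, since
    otherwise the recursion would make the last minor vanish too. *)
Lemma diagonal_form_nondegenerate d n : cont d n != 0 ->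
  exists2 s, has_diagonal_form n (Jform d n) s & forall i, (i < n)%N -> s i != 0.
Proof.
elim/ltn_ind: n => [[|n]] IH h.
  by exists (fun=> 0) => //; exact: diagonal_form0.
have [h0|h0] := eqVneq (cont d n) 0; last first.
  have [s ds hs] := IH n (ltnSn n) h0.
  exists (snoc s n (cont d n.+1 / cont d n)); first exact: diagonal_form_step.
  move=> i; rewrite ltnS leq_eqVlt => /orP[/eqP ->|hi].
    by rewrite snoc_last mulf_neq0 ?invr_eq0.
  by rewrite snoc_lt // hs.
case: n IH h h0 => [|n] IH h h0; first by have := oner_neq0 R; rewrite -(cont0 d) h0 eqxx.
have h1 : cont d n != 0.
  by apply: contraNneq h => h1; rewrite contS h0 /= h1 mulr0 subr0.
have [s ds hs] := IH n (leqnSn _) h1.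
exists (snoc (snoc s n (- 2^-1)) n.+1 (2^-1)).
  exact: diagonal_form_hyp_step.
move=> i; rewrite ltnS leq_eqVlt => /orP[/eqP ->|].
  by rewrite snoc_last invr_eq0 pnatr_eq0.
move=> hi; rewrite snoc_lt //; move: hi; rewrite ltnS leq_eqVlt.
move=> /orP[/eqP ->|hi]; last by rewrite snoc_lt // hs.
by rewrite snoc_last oppr_eq0 invr_eq0 pnatr_eq0.
Qed.

Definition negs n s := [seq i <- iota 0 n | s i < 0].

Lemma negs_snoc n s a :
  size (negs n.+1 (snoc s n a)) = (size (negs n s) + (a < 0)%R)%N.
Proof.
rewrite /negs -[n.+1]addn1 iotaD filter_cat size_cat /= add0n snoc_last.
congr (_ + _)%N; last by case: ifP.
congr size; apply: eq_in_filter => i; rewrite mem_iota add0n => /andP[_ hi].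
by rewrite snoc_lt.
Qed.

Lemma mem_negs n s i : (i \in negs n s) = (i < n)%N && (s i < 0).
Proof. by rewrite mem_filter mem_iota add0n leq0n andbC. Qed.

Lemma negs_uniq n s : uniq (negs n s).
Proof. by rewrite filter_uniq // iota_uniq. Qed.

(** Zero coefficients are allowed: at a virtual level the form is degenerate. *)
Definition has_negative_index n (q : cseq R -> R) k :=
  exists2 s, has_diagonal_form n q s & size (negs n s) = k.

End JacobiInertia.

(** * The components of Dom(Phi_n) *)

Section ComponentsInertia.
Variable R : realType.

(** The first entry is (2 + 2 mu_1) / 2: multiplying the first coordinate by sqrt 2 halves the
    diagonal entry and turns a_1 into -1. *)
Definition free_diag n (z : 'rV[R]_n) (k : nat) : R :=
  if k == 0%N then 1 + entry z 0 else 2 + entry z k.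

Lemma Q_cont n d (z : 'rV[R]_d) : Q n z = cont (free_diag z) n.
Proof.
rewrite /Q; elim/ltn_ind: n => -[|[|n]] IH; first by rewrite cont0.
  by rewrite contS cont0 mulr1 subr0.
rewrite contS /pcont -(IH n.+1) // -(IH n) //; exact: ltnW.
Qed.

Lemma entry_pt_init n (z : 'rV[R]_n.+1) k : (k < n)%N ->
  entry (pt_init z) k = entry z k.
Proof.
move=> hk; rewrite /entry (insubT (fun i => i < n)%N hk).
rewrite (insubT (fun i => i < n.+1)%N (ltnW hk)) mxE /=.
by congr (z _ _); apply: val_inj.
Qed.

Lemma entry_pt_last n (z : 'rV[R]_n.+1) : entry z n = pt_last z.
Proof.
rewrite /entry (insubT (fun i => i < n.+1)%N (ltnSn n)) /pt_last /=.
by congr (z _ _); apply: val_inj.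
Qed.

Lemma free_diag_pt_init n (z : 'rV[R]_n.+1) k : (k < n)%N ->
  free_diag (pt_init z) k = free_diag z k.
Proof.
move=> hk; rewrite /free_diag; case: eqP => [k0|_]; last by rewrite entry_pt_init.
by rewrite entry_pt_init // -k0.
Qed.

Lemma cont_pt_init n (z : 'rV[R]_n.+1) p : (p <= n)%N ->
  cont (free_diag (pt_init z)) p = cont (free_diag z) p.
Proof.
by move=> hp; apply: eq_cont => k hk; rewrite free_diag_pt_init // (leq_trans hk).
Qed.

(** Reading Q_(-1) as 0 puts the convention Phi_0 = -1 under the general formula; the constant is
    then 1 instead of 2 because the first diagonal entry is 1 + mu_1. *)
Lemma Phi_cont n (z : 'rV[R]_n) :
  Phi z = (pcont (free_diag z) n) / cont (free_diag z) n - (if n == 0%N then 1 else 2).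
Proof.
rewrite /Phi; case: n z => [|n] z; last by rewrite !Q_cont.
by rewrite /= mul0r add0r.
Qed.

(** The pivot Q_(n+1) / Q_n is mu_(n+1) - Phi_n, so epigraph and hypograph are the two signs of the
    pivot. *)
Lemma cont_Phi n (z : 'rV[R]_n.+1) : cont (free_diag z) n != 0 ->
  cont (free_diag z) n.+1 =
  cont (free_diag z) n * (pt_last z - Phi (pt_init z)).
Proof.
move=> h; rewrite Phi_cont cont_pt_init // contS.
have -> : pcont (free_diag (pt_init z)) n = pcont (free_diag z) n.
  by case: n z h => //= n z h; rewrite cont_pt_init.
rewrite {1}/free_diag -entry_pt_last.
by case: n z h => [|n] z h /=; [field|field]; move: h.
Qed.

Lemma D_index n : forall k (z : 'rV[R]_n), D n k z ->
  [/\ cont (free_diag z) n != 0, (k <= n)%N &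
      has_negative_index n (Jform (free_diag z) n) k].
Proof.
pose P n := forall k (z : 'rV[R]_n), D n k z ->
  [/\ cont (free_diag z) n != 0, (k <= n)%N &
      has_negative_index n (Jform (free_diag z) n) k].
have sub p (z : 'rV[R]_p.+1) k :
    has_negative_index p (Jform (free_diag (pt_init z)) p) k ->
    has_negative_index p (Jform (free_diag z) p) k.
  case=> s ds sk; exists s => //; apply: eq_diagonal_form ds => // x.
  by apply: eq_Jform => // i; exact: free_diag_pt_init.
have step p (z : 'rV[R]_p.+1) k : cont (free_diag z) p != 0 ->
    has_negative_index p (Jform (free_diag z) p) k ->
    has_negative_index p.+1 (Jform (free_diag z) p.+1)
      (k + (pt_last z < Phi (pt_init z))%R)%N.
  move=> h [s ds sk]; have := diagonal_form_step h ds.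
  rewrite cont_Phi // [X in X / _]mulrC mulfK // => ds'.
  by exists (snoc s p (pt_last z - Phi (pt_init z))); rewrite // negs_snoc sk subr_lt0.
have epiP p k z : P p -> epi (@Phi R p) (D p k) z ->
    [/\ cont (free_diag z) p.+1 != 0, (k <= p.+1)%N &
      has_negative_index p.+1 (Jform (free_diag z) p.+1) k].
  move=> IH [/IH [h1 h2 h3] h4]; rewrite cont_pt_init // in h1.
  split; [|exact: leq_trans h2 _|].
    by rewrite cont_Phi // mulf_neq0 // subr_eq0 gt_eqF.
  by have := step _ _ _ h1 (sub _ _ _ h3); rewrite ltNge (ltW h4) addn0.
have hypoP p k z : P p -> hypo (@Phi R p) (D p k) z ->
    [/\ cont (free_diag z) p.+1 != 0, (k.+1 <= p.+1)%N &
      has_negative_index p.+1 (Jform (free_diag z) p.+1) k.+1].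
  move=> IH [/IH [h1 h2 h3] h4]; rewrite cont_pt_init // in h1.
  split; [|by rewrite ltnS|].
    by rewrite cont_Phi // mulf_neq0 // subr_eq0 lt_eqF.
  by have := step _ _ _ h1 (sub _ _ _ h3); rewrite h4 addn1.
(* [D_step] refers to the two preceding dimensions, so the induction carries a pair. *)
suff : P n /\ P n.+1 by case.
have P0 : P 0%N.
  move=> k z; rewrite /D /= /D_0; case: eqP => // -> _; split => //.
    by rewrite cont0 oner_eq0.
  by exists (fun=> 0) => //; exact: diagonal_form0.
elim: n => [|n [IH1 IH2]]; split => //.
- move=> k z; rewrite /D /= /D_1.
  (* In dimension 1 the sets are the epigraph and the hypograph of Phi_0 = -1 over a point. *)
  have e0 : pt_last z = z ord0 ord0 by congr (z _ _); apply: val_inj.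
  case: k => [|[|]] //= hz.
    by apply: (epiP 0%N 0%N) => //; split=> //; rewrite e0.
  by apply: (hypoP 0%N 0%N) => //; split=> //; rewrite e0.
- move=> k z; rewrite /D /= /D_step; case: k => [|j].
    exact: (epiP n.+1 0%N).
  case: ifP => hj; last case: eqP => // e; last first.
    by case: e => ->; exact: (hypoP n.+1 n.+1).
  case=> [[|]|].
  + exact: (hypoP n.+1 j).
  (* Over the graph of Phi_n one has Q_(n+1) = 0; the last two coordinates form a hyperbolic block,
     which raises the index from j to j + 1. *)
  + case=> /IH1 [h1 h2 h3] h4.
    have h0 : cont (free_diag z) n.+1 = 0.
      have hp : cont (free_diag (pt_init z)) n != 0.
        by rewrite -(@cont_pt_init _ (pt_init z) n (leqnn n)).
      by rewrite -cont_pt_init // cont_Phi // h4 subrr mulr0.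
    rewrite !cont_pt_init // in h1.
    split; [|by rewrite ltnS ltnW|].
      by rewrite contS h0 mulr0 sub0r oppr_eq0.
    have [s ds sk] := sub _ _ _ h3.
    have {}ds : has_diagonal_form n (Jform (free_diag z) n) s.
      apply: eq_diagonal_form ds => // x; apply: eq_Jform => // i hi.
      by rewrite free_diag_pt_init // ltnW.
    exists (snoc (snoc s n (- 2^-1)) n.+1 (2^-1)).
      exact: diagonal_form_hyp_step.
    by rewrite !negs_snoc sk oppr_lt0 invr_gt0 ltr0n invr_lt0 ltrn0 addn0 addn1.
  + exact: (epiP n.+1 j.+1).
Qed.

(** If Q_(n-1) is nonzero, the last coordinate differs from Phi_(n-1) because Q_n is nonzero. If
    Q_(n-1) = 0, then Q_(n-2) is nonzero and the point lies over the graph of Phi_(n-2). *)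
Lemma D_cover n (z : 'rV[R]_n) : cont (free_diag z) n != 0 ->
  exists2 k, (k <= n)%N & D n k z.
Proof.
pose P n := forall z : 'rV[R]_n, cont (free_diag z) n != 0 ->
  exists2 k, (k <= n)%N & D n k z.
suff : P n /\ P n.+1 by case=> + _; apply.
elim: {z} n => [|n [IH1 IH2]]; split => //.
- by move=> z _; exists 0%N.
- move=> z; rewrite contS cont0 mulr1 /pcont subr0 /D /= /free_diag /= entry_pt_last.
  have -> : pt_last z = z ord0 ord0 by congr (z _ _); apply: val_inj.
  move=> h; have : z ord0 ord0 != -1 by rewrite -subr_eq0 opprK addrC.
  by rewrite neq_lt => /orP[] hz; [exists 1%N|exists 0%N].
move=> z h.
have [h0|h0] := eqVneq (cont (free_diag z) n.+1) 0; last first.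
  have [|k hk hD] := IH2 (pt_init z); first by rewrite cont_pt_init.
  have : pt_last z != Phi (pt_init z).
    by apply: contraNneq h => e; rewrite cont_Phi // e subrr mulr0.
  rewrite neq_lt => /orP[] hz.
    exists k.+1; first by rewrite ltnS.
    rewrite /D /= /D_step; case: ifP => hk1; first by left; left; split.
    have ek : k = n.+1 by apply/eqP; rewrite eqn_leq hk leqNgt hk1.
    by rewrite ek in hD *; rewrite eqxx.
  exists k; first by rewrite (leq_trans hk).
  rewrite /D /= /D_step; case: k hk hD => [|k] hk hD; first by split.
  by rewrite hk; right.
have h1 : cont (free_diag z) n != 0.
  by apply: contraNneq h => h1; rewrite contS h0 /= h1 mulr0 subr0.
have [|k hk hD] := IH1 (pt_init (pt_init z)); first by rewrite !cont_pt_init.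
exists k.+1; first by rewrite ltnS ltnW.
rewrite /D /= /D_step ltnS hk; left; right; split => //.
have := h0; rewrite -cont_pt_init // cont_Phi ?cont_pt_init // => /eqP.
by rewrite mulf_eq0 (negbTE h1) /= subr_eq0 => /eqP.
Qed.

End ComponentsInertia.

(** * Square-summable sequences *)

Section SquareSummable.
Variable R : realType.
Local Notation C := R[i].
Implicit Types (x y z : cseq R).

Lemma normc_sqr (w : C) : Normc.normc w ^+ 2 = redot w w.
Proof.
case: w => a b; rewrite /redot /Normc.normc /= sqr_sqrtr ?expr2 //.
by rewrite -!expr2 addr_ge0 ?sqr_ge0.
Qed.

Lemma l2P x : l2 x <-> exists M : R, forall n, \sum_(k < n) redot (x k) (x k) <= M.
Proof.
have pos n : (0 <= n)%N -> true -> (0%E <= ((Normc.normc (x n)) ^+ 2)%:E)%E.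
  by rewrite lee_fin sqr_ge0.
have part n : (\sum_(0 <= k < n) ((Normc.normc (x k)) ^+ 2)%:E =
   (\sum_(k < n) redot (x k) (x k))%:E)%E.
  by rewrite big_mkord sumEFin; congr _%:E; apply: eq_bigr => i _; rewrite normc_sqr.
split; rewrite /l2 /=.
  set S := (\sum_(0 <= k <oo) _)%E => Soo.
  exists (fine S) => n; rewrite -lee_fin fineK; last first.
    by rewrite ge0_fin_numE // nneseries_ge0.
  by rewrite -part; apply: nneseries_lim_ge.
move=> [M hM]; apply: (@le_lt_trans _ _ M%:E); last by rewrite ltry.
apply: lime_le; first by apply: is_cvg_nneseries => n _ _; exact: pos.
by apply: nearW => n; rewrite part lee_fin; exact: hM.
Qed.

Lemma l2_cvg x : l2 x -> cvgn (series (fun k => redot (x k) (x k))).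
Proof.
move=> /l2P[M hM]; apply: nondecreasing_is_cvgn.
  by apply: nondecreasing_series => k _ _; exact: redot_ge0.
by exists M => _ [n _ <-]; rewrite /series /= big_mkord; exact: hM.
Qed.

Lemma l2_dominated x (w : nat -> R) y : l2 x -> l2 y ->
  (forall k, `|w k| <= redot (x k) (x k) + redot (y k) (y k)) ->
  cvgn (series w).
Proof.
move=> /l2_cvg hx /l2_cvg hy hw; apply: normed_cvg.
apply: (@series_le_cvg _ _ (fun k => redot (x k) (x k) + redot (y k) (y k))) => //.
- by move=> n; exact: normr_ge0.
- by move=> n; rewrite addr_ge0 // redot_ge0.
- rewrite (_ : (fun k => _) =
    (fun k => redot (x k) (x k)) \+ (fun k => redot (y k) (y k))) //.
  exact: (is_cvg_seriesD hx hy).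
Qed.

Lemma l2_axpy a x y : l2 x -> l2 y -> l2 (axpy a x y).
Proof.
move=> /l2P[A hA] /l2P[B hB]; apply/l2P.
exists (2 * (redot a a * A) + 2 * B) => n.
apply: (@le_trans _ _ (2 * (redot a a * \sum_(k < n) redot (x k) (x k)) +
   2 * \sum_(k < n) redot (y k) (y k))).
  rewrite !mulr_sumr -big_split /=; apply: ler_sum => i _.
  by rewrite -redotM; exact: redot_add_le.
by rewrite lerD // ler_wpM2l // ler_wpM2l // redot_ge0.
Qed.

Lemma l2_finite x n : (forall k, (n <= k)%N -> x k = 0) -> l2 x.
Proof.
move=> h; apply/l2P; exists (\sum_(k < n) redot (x k) (x k)) => m.
have r0 k : 0 <= redot (x k) (x k) by exact: redot_ge0.
rewrite -!(big_mkord xpredT (fun k => redot (x k) (x k))).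
case: (leqP m n) => mn.
  by rewrite (@big_cat_nat _ _ _ m 0 n) //= lerDl sumr_ge0.
rewrite (@big_cat_nat _ _ _ n 0 m) ?(ltnW mn) //= gerDl.
rewrite big_nat_cond big1 // => k; rewrite andbT => /andP[nk _].
by rewrite h // /redot /= mulr0 addr0.
Qed.

Lemma l2_linear_subspace : linear_subspace (@l2 R).
Proof.
split; first by apply: (@l2_finite _ 0%N).
by move=> a x y; exact: l2_axpy.
Qed.

Lemma l2_basis k : l2 (basis_vec R k).
Proof. by apply: (@l2_finite (basis_vec R k) k.+1) => j hj; rewrite /basis_vec gtn_eqF. Qed.

Lemma l2_redot0 x : l2 x -> (fun k => redot (x k) (x k)) @ \oo --> 0.
Proof. by move=> /l2_cvg; exact: cvg_series_cvg_0. Qed.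

Lemma l2_shift x : l2 x -> l2 (fun k => x k.+1).
Proof.
move=> /l2P[M hM]; apply/l2P; exists M => n; apply: le_trans (hM n.+1).
by rewrite big_ord_recl /= lerDr redot_ge0.
Qed.

Lemma l2_unshift x : l2 x -> l2 (pred_term x).
Proof.
move=> /l2P[M hM]; apply/l2P; exists M => -[|n].
  by apply: le_trans (hM 0%N); rewrite !big_ord0.
by rewrite big_ord_recl /= {1}/redot mulr0 addr0 add0r; exact: hM.
Qed.

Definition inner_term x y k : C := x k * (y k)^*.

Definition cvg_inner x y (v : C) :=
  series (fun k => complex.Re (inner_term x y k)) @ \oo --> complex.Re v /\
  series (fun k => complex.Im (inner_term x y k)) @ \oo --> complex.Im v.

Lemma cvg_inner_lim x y v : cvg_inner x y v -> inner x y = v.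
Proof.
move=> [h1 h2]; rewrite /inner.
by rewrite (cvg_lim (@Rhausdorff R) h1) (cvg_lim (@Rhausdorff R) h2); case: v {h1 h2}.
Qed.

Lemma Re_innerE x y k : complex.Re (inner_term x y k) = redot (x k) (y k).
Proof. by rewrite /inner_term /redot !partsE; ring. Qed.

(** Multiplication by -i turns an imaginary part into a real one, so that estimates for [redot]
    serve both parts. *)
Lemma Im_innerE x y k : complex.Im (inner_term x y k) = redot (-'i%C * x k) (y k).
Proof. by rewrite /inner_term /redot !partsE /=; ring. Qed.

Lemma redot_Ni (w : C) : redot (-'i%C * w) (-'i%C * w) = redot w w.
Proof. by rewrite /redot !partsE /=; ring. Qed.

Lemma l2_inner x y : l2 x -> l2 y -> cvg_inner x y (inner x y).
Proof.
move=> hx hy; split; apply: (l2_dominated hx hy) => k.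
  by rewrite Re_innerE redot_le.
by rewrite Im_innerE (le_trans (redot_le _ _)) // redot_Ni.
Qed.

Lemma inner_axpyl a x y z : l2 x -> l2 y -> l2 z ->
  inner (axpy a x y) z = a * inner x z + inner y z.
Proof.
move=> hx hy hz; apply: cvg_inner_lim.
have [h1 h2] := l2_inner hx hz; have [h3 h4] := l2_inner hy hz.
split; rewrite !partsE.
  rewrite (_ : series _ = (fun n => complex.Re a *
      series (fun k => complex.Re (inner_term x z k)) n -
      complex.Im a * series (fun k => complex.Im (inner_term x z k)) n +
      series (fun k => complex.Re (inner_term y z k)) n)).
    by apply: cvgD => //; apply: cvgB; exact: cvgMl_tmp.
  apply/funext => n; rewrite /series /= !mulr_sumr -sumrB -big_split /=.
  by apply: eq_bigr => k _; rewrite /inner_term /axpy !partsE; ring.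
rewrite (_ : series _ = (fun n => complex.Re a *
    series (fun k => complex.Im (inner_term x z k)) n +
    complex.Im a * series (fun k => complex.Re (inner_term x z k)) n +
    series (fun k => complex.Im (inner_term y z k)) n)).
  by apply: cvgD => //; apply: cvgD; exact: cvgMl_tmp.
apply/funext => n; rewrite /series /= !mulr_sumr -!big_split /=.
by apply: eq_bigr => k _; rewrite /inner_term /axpy !partsE; ring.
Qed.

Lemma inner_conj x y : l2 x -> l2 y -> inner y x = (inner x y)^*.
Proof.
move=> hx hy; apply: cvg_inner_lim; have [h1 h2] := l2_inner hx hy.
split; rewrite !partsE.
  rewrite (_ : (fun k => _) = (fun k => complex.Re (inner_term x y k))) //.
  by apply/funext => k; rewrite /inner_term !partsE; ring.
rewrite (_ : series _ = fun n => - series (fun k => complex.Im (inner_term x y k)) n).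
  exact: cvgN.
apply/funext => n; rewrite /series /= -sumrN; apply: eq_bigr => k _.
by rewrite /inner_term !partsE; ring.
Qed.

Lemma inner_functional z : l2 z -> functional_on (@l2 R) (fun x => inner x z).
Proof. by move=> hz a x y hx hy; exact: inner_axpyl. Qed.

Lemma inner0l z : l2 z -> inner (fun=> 0) z = 0.
Proof. by move=> hz; apply: (functional_on0 l2_linear_subspace (inner_functional hz)). Qed.

Lemma inner0r z : l2 z -> inner z (fun=> 0) = 0.
Proof.
move=> hz; have [h0 _] := l2_linear_subspace.
by rewrite (inner_conj h0 hz) inner0l // rmorph0.
Qed.

Lemma inner_axpyr a x y z : l2 x -> l2 y -> l2 z ->
  inner z (axpy a x y) = a^* * inner z x + inner z y.
Proof.
move=> hx hy hz; rewrite inner_conj //; last exact: l2_axpy.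
rewrite inner_axpyl // rmorphD rmorphM /= -!inner_conj //.
Qed.

Lemma inner_basis x k : l2 x -> inner x (basis_vec R k) = x k.
Proof.
move=> hx; apply: cvg_inner_lim.
have e n : (k < n)%N -> \sum_(0 <= j < n) inner_term x (basis_vec R k) j = x k.
  move=> kn; rewrite big_mkord (bigD1 (Ordinal kn)) //= /inner_term /basis_vec.
  rewrite eqxx rmorph1 mulr1 big1 ?addr0 // => j hj.
  suff -> : (j == k :> nat) = false by rewrite rmorph0 mulr0.
  by apply/negbTE; apply: contraNneq hj => e; apply/eqP/val_inj.
have re n : series (fun j => complex.Re (inner_term x (basis_vec R k) j)) n =
    complex.Re (\sum_(0 <= j < n) inner_term x (basis_vec R k) j).
  by rewrite (big_morph (@complex.Re R) (@ReD R) (erefl _)).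
have im n : series (fun j => complex.Im (inner_term x (basis_vec R k) j)) n =
    complex.Im (\sum_(0 <= j < n) inner_term x (basis_vec R k) j).
  by rewrite (big_morph (@complex.Im R) (@ImD R) (erefl _)).
split; apply: cvg_near_cst; exists k.+1 => // n /= kn; by rewrite ?re ?im e.
Qed.

Lemma inner_ge x n : l2 x ->
  \sum_(k < n) redot (x k) (x k) <= complex.Re (inner x x).
Proof.
move=> hx; have [+ _] := l2_inner hx hx.
rewrite (_ : (fun k => _) = (fun k => redot (x k) (x k))); last first.
  by apply/funext => k; rewrite Re_innerE.
move=> h; rewrite -(cvg_lim (@Rhausdorff R) h).
rewrite -(big_mkord xpredT (fun k => redot (x k) (x k))).
apply: (nondecreasing_cvgn_le (u_ := series (fun k => redot (x k) (x k)))).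
  by apply: nondecreasing_series => k _ _; exact: redot_ge0.
exact: l2_cvg.
Qed.

Lemma inner_real x : l2 x -> inner x x = (complex.Re (inner x x))%:C.
Proof.
move=> hx; apply: complex_ext => //=.
have := congr1 (@complex.Im R) (inner_conj hx hx); rewrite ImJ => e.
by apply/eqP; rewrite -eqNr -e.
Qed.

Lemma inner_self_gt0 x : l2 x -> x <> (fun=> 0) -> 0 < complex.Re (inner x x).
Proof.
move=> hx x0; have [k xk] : exists k, x k != 0.
  by apply: contrapT => /forallNP h; apply: x0; apply/funext => k;
     apply: contrapT => /eqP; exact: h.
apply: lt_le_trans (inner_ge k.+1 hx); rewrite big_ord_recr /=.
by rewrite ltr_wpDl ?redot_gt0 // sumr_ge0 // => i _; exact: redot_ge0.
Qed.

Lemma inner_self_eq0 x : l2 x -> inner x x = 0 -> x = fun=> 0.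
Proof.
move=> hx e; apply: contrapT => /(inner_self_gt0 hx).
by rewrite e ltxx.
Qed.

End SquareSummable.

(** * Spectral projection on the negative half-line *)

Section SecondMoment.
Variable R : realType.
Local Notation mR := (measurableTypeR R).
Variable m : {measure set mR -> \bar R}.
Hypothesis m_fin : (m setT < +oo)%E.
Hypothesis m_sqr : m.-integrable setT (fun t => (t ^+ 2)%:E).

(** By |t| <= 1 + t^2 and the finiteness of the mass. *)
Lemma integrable_first_moment : m.-integrable setT (EFin \o @id mR).
Proof.
have i1 : m.-integrable setT (cst 1%E).
  apply/integrableP; split; first exact: measurable_cst.
  rewrite (eq_integral (cst 1%E)) ?integral_cst ?mul1e // => t _.
  by rewrite /= normr1.
have := integrableD measurableT i1 m_sqr.
apply: le_integrable => //; first by apply/measurable_EFinP.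
move=> t _ /=; rewrite lee_fin.
have t2 := sqr_ge0 t.
rewrite [leRHS]ger0_norm; last by rewrite addr_ge0.
rewrite ler_norml; have := sqr_ge0 (t + 1); have := sqr_ge0 (t - 1).
by move=> h1 h2; apply/andP; split; nra.
Qed.

Local Notation neg := (`]-oo, 0[%classic : set R).
Local Notation pos := (`[0, +oo[%classic : set R).

Lemma neg_pos_setT : (setT : set R) = neg `|` pos.
Proof.
apply/seteqP; split => // t _; rewrite /= !in_itv /= andbT.
by case: (ltP t 0) => h; [left|right].
Qed.

Lemma neg_pos_disj : [disjoint neg & pos].
Proof.
apply/eqP/seteqP; split => // t [] /=; rewrite !in_itv /= andbT.
by move=> h; rewrite leNgt h.
Qed.

Lemma first_moment_split :
  Rintegral m setT (fun t => t) =
  Rintegral m neg (fun t => t) + Rintegral m pos (fun t => t).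
Proof.
rewrite neg_pos_setT Rintegral_setU //; last exact: neg_pos_disj.
by rewrite -neg_pos_setT; exact: integrable_first_moment.
Qed.

Lemma null_first_moment (B : set mR) : measurable B -> m B = 0%E ->
  Rintegral m B (fun t => t) = 0.
Proof.
by move=> mB B0; rewrite /Rintegral null_set_integral.
Qed.

Lemma first_moment_pos : 0 <= Rintegral m pos (fun t => t).
Proof. by apply: Rintegral_ge0 => t /=; rewrite in_itv /= andbT. Qed.

(** A vanishing integral of |t| would make the half-line a null set, as t is nonzero there. *)
Lemma first_moment_neg : m neg != 0%E -> Rintegral m neg (fun t => t) < 0.
Proof.
move=> h.
have measurable_negative : measurable (neg : set mR) by exact: measurable_itv.
have ii : m.-integrable neg (EFin \o @id mR).
  by apply: (integrableS measurableT) integrable_first_moment.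
have e : (\int[m]_(t in neg) `|t|%:E = - \int[m]_(t in neg) t%:E)%E.
  rewrite -integralN; last first.
    exact: integrable_add_def.
  apply: eq_integral => t; rewrite inE /= in_itv /= => t0.
  by rewrite ltr0_norm.
have fin : (\int[m]_(t in neg) t%:E)%E \is a fin_num.
  exact: integrable_fin_num.
have : (0 <= \int[m]_(t in neg) `|t|%:E)%E.
  by apply: integral_ge0 => t _; rewrite lee_fin.
rewrite le_eqVlt => /orP[/eqP/esym z|].
  move/eqP: h; case.
  have mf : measurable_fun neg (fun t : mR => t%:E).
    by apply/measurable_EFinP; exact: measurable_id.
  have /(ae_eq_integral_abs m measurable_negative mf) : (\int[m]_(t in neg) `|t%:E| = 0)%E.
    by rewrite -[RHS]z; apply: eq_integral.
  move=> h; have : m.-negligible neg.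
    apply: negligibleS h => t /= tn; apply/not_implyP; split => //.
    by move: tn; rewrite in_itv /= => t0 /eqP; rewrite /cst eqe lt_eqF.
  by move/negligibleP; exact.
rewrite e oppe_gt0 => h'; rewrite /Rintegral -lte_fin fineK //.
Qed.

End SecondMoment.

(** * Range and kernel of the negative spectral projection *)

Section SpectralProjection.
Variable R : realType.
Local Notation mR := (measurableTypeR R).
Local Notation C := R[i].
Variables (A : operator R) (E : set R -> operator R).
Hypothesis A_l2 : forall x, l2 x -> l2 (A x).
Hypothesis A_lin : linear_op A.
Hypothesis A_sym : forall x y, l2 x -> l2 y -> inner (A x) y = inner x (A y).
Hypothesis E_spec : spectral_measure A E.
Implicit Types (x y : cseq R) (B : set mR).

Local Notation neg := (`]-oo, 0[%classic : set R).
Local Notation pos := (`[0, +oo[%classic : set R).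
Local Notation P := (E neg).

Lemma measurable_negative : measurable (neg : set mR). Proof. exact: measurable_itv. Qed.
Lemma measurable_nonnegative : measurable (pos : set mR). Proof. exact: measurable_itv. Qed.

Lemma E_l2 B x : measurable B -> l2 x -> l2 (E B x).
Proof. by move=> mB; have [+ _ _] := E_spec; move=> /(_ B mB)[+ _ _ _]; exact. Qed.

Lemma E_axpy B a x y : measurable B -> l2 x -> l2 y ->
  E B (axpy a x y) = axpy a (E B x) (E B y).
Proof. by move=> mB; have [+ _ _] := E_spec; move=> /(_ B mB)[_ + _ _]; exact. Qed.

Lemma E0 B : measurable B -> E B (fun=> 0) = fun=> 0.
Proof.
move=> mB; have [h0 _] := l2_linear_subspace R.
by have := E_axpy (-1) mB h0 h0; rewrite axpy0 scale0 axpyN1.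
Qed.

Lemma E_idem B x : measurable B -> l2 x -> E B (E B x) = E B x.
Proof. by move=> mB; have [+ _ _] := E_spec; move=> /(_ B mB)[_ _ + _]; exact. Qed.

Lemma E_sym B x y : measurable B -> l2 x -> l2 y ->
  inner (E B x) y = inner x (E B y).
Proof. by move=> mB; have [+ _ _] := E_spec; move=> /(_ B mB)[_ _ _]; exact. Qed.

Lemma E_normsq B x : measurable B -> l2 x -> inner (E B x) x = inner (E B x) (E B x).
Proof. by move=> mB hx; rewrite -[in RHS]E_sym ?E_idem //; exact: E_l2. Qed.

Lemma spectral_measureP x : l2 x ->
  exists m : {measure set mR -> \bar R},
    [/\ (forall B, measurable B -> m B = (complex.Re (inner (E B x) x))%:E),
        (m setT < +oo)%E, m.-integrable setT (fun t => (t ^+ 2)%:E) &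
        complex.Re (inner (A x) x) = Rintegral m setT (fun t => t)].
Proof.
move=> hx; have [_ _ /(_ x hx)[m [h1 h2 h3]]] := E_spec.
by exists m; split; rewrite // ?h3 // h1 // ltry.
Qed.

(** For x in ran P the negative half-line already has mass <P x, x> = <x, x>, which is the total
    mass. *)
Lemma measure_pos_eq0 x (m : {measure set mR -> \bar R}) : l2 x -> P x = x ->
  (forall B, measurable B -> m B = (complex.Re (inner (E B x) x))%:E) ->
  m pos = 0%E.
Proof.
move=> hx Px hm.
have : m setT = (m neg + m pos)%E.
  rewrite (neg_pos_setT R) measureU //.
  by apply/eqP; exact: neg_pos_disj.
have [_ ET _] := E_spec.
rewrite (hm setT) // (hm neg) //.
rewrite Px ET // hm //.
by rewrite -EFinD => /eqP; rewrite eqe -[eqbLHS]addr0 => /eqP/addrI <-.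
Qed.

Lemma form_lt0 x : l2 x -> P x = x -> x <> (fun=> 0) ->
  complex.Re (inner (A x) x) < 0.
Proof.
move=> hx Px x0; have [m [h1 h2 h3 ->]] := spectral_measureP hx.
have m0 := measure_pos_eq0 hx Px h1.
rewrite first_moment_split // (null_first_moment measurable_nonnegative m0).
rewrite addr0; apply: first_moment_neg => //.
by rewrite h1 ?Px // eqe gt_eqF // inner_self_gt0.
Qed.

Lemma form_ge0 x : l2 x -> P x = (fun=> 0) -> 0 <= complex.Re (inner (A x) x).
Proof.
move=> hx Px; have [m [h1 h2 h3 ->]] := spectral_measureP hx.
have m0 : m neg = 0%E by rewrite h1 ?Px ?inner0l.
rewrite first_moment_split // (null_first_moment measurable_negative m0) add0r.
exact: first_moment_pos.
Qed.

(** Subsets of a null set are null, and the mass of B is |E(B) x|^2. This takes the place of a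
    product rule for E. *)
Lemma E_null_sub B x (m : {measure set mR -> \bar R}) (B' : set mR) :
  measurable B -> measurable B' -> B `<=` B' -> l2 x ->
  (forall B, measurable B -> m B = (complex.Re (inner (E B x) x))%:E) ->
  m B' = 0%E -> E B x = (fun=> 0).
Proof.
move=> mB mB' BB' hx hm B'0.
have B0 : m B = 0%E.
  by apply/eqP; rewrite eq_le measure_ge0 andbT -B'0 le_measure ?inE.
apply: inner_self_eq0; first exact: E_l2.
rewrite inner_real; last exact: E_l2.
by rewrite -E_normsq //; move: B0; rewrite hm // => /eqP; rewrite eqe => /eqP ->.
Qed.

(* Additivity of the form on the sum of a vector of ran P and one of ker P: the
   scalar spectral measure of the sum is that of x on the negative half-line
   and that of y on the nonnegative one. *)
Lemma form_add x y : l2 x -> l2 y -> P x = x -> P y = (fun=> 0) ->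
  complex.Re (inner (A (axpy 1 x y)) (axpy 1 x y)) =
  complex.Re (inner (A x) x) + complex.Re (inner (A y) y).
Proof.
move=> hx hy Px Py; have hz := l2_axpy 1 hx hy; set z := axpy 1 x y in hz *.
have [mx [x1 x2 x3 ->]] := spectral_measureP hx.
have [my [y1 y2 y3 ->]] := spectral_measureP hy.
have [mz [z1 z2 z3 ->]] := spectral_measureP hz.
have xpos := measure_pos_eq0 hx Px x1.
have yneg : my neg = 0%E by rewrite y1 ?Py ?inner0l.
rewrite !first_moment_split // (null_first_moment measurable_nonnegative xpos).
rewrite (null_first_moment measurable_negative yneg) addr0 add0r; congr (_ + _).
  congr fine; apply: eq_measure_integral => B mB sB.
  rewrite z1 // x1 // E_axpy // (E_null_sub mB measurable_negative sB hy y1 yneg).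
  rewrite (_ : axpy 1 _ _ = E B x); last first.
    by apply/funext => k; rewrite /axpy mul1r addr0.
  have hB := E_l2 mB hx.
  rewrite inner_axpyr // (E_sym _ hx hy) //.
  rewrite (E_null_sub mB measurable_negative sB hy y1 yneg) inner0r // addr0.
  by rewrite rmorph1 mul1r.
congr fine; apply: eq_measure_integral => B mB sB.
rewrite z1 // y1 // E_axpy // (E_null_sub mB measurable_nonnegative sB hx x1 xpos).
rewrite (_ : axpy 1 _ _ = E B y); last first.
  by apply/funext => k; rewrite /axpy mul1r add0r.
have hB := E_l2 mB hy.
rewrite inner_axpyr // (E_sym _ hy hx) //.
by rewrite (E_null_sub mB measurable_nonnegative sB hx x1 xpos) inner0r // mulr0 add0r.
Qed.

(** Additivity of the form removes the real part of the cross term <A x, y>; with -i x in place of x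
    it removes the imaginary part. *)
Lemma form_orthogonal x y : l2 x -> l2 y -> P x = x -> P y = (fun=> 0) ->
  inner (A x) y = 0.
Proof.
have cross u v : l2 u -> l2 v -> P u = u -> P v = (fun=> 0) ->
    complex.Re (inner (A u) v) = 0.
  move=> hu hv Pu Pv; have := form_add hu hv Pu Pv.
  have hAu := A_l2 hu; have hAv := A_l2 hv.
  rewrite A_lin inner_axpyl //; last exact: l2_axpy.
  rewrite !inner_axpyr // rmorph1 !mul1r !ReD.
  have -> : complex.Re (inner (A v) u) = complex.Re (inner (A u) v).
    by rewrite A_sym // inner_conj // ReJ.
  set a := complex.Re (inner (A u) u); set b := complex.Re (inner (A v) v).
  set c := complex.Re (inner (A u) v); lra.
move=> hx hy Px Py; apply: complex_ext; first exact: cross.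
have [h0 _] := @l2_linear_subspace R.
pose x' := axpy (-'i%C) x (fun=> 0).
have hx' : l2 x' by exact: l2_axpy.
have P0 := E0 measurable_negative.
have Px' : P x' = x'.
  by rewrite /x' E_axpy ?Px ?P0.
have := cross _ _ hx' hy Px' Py.
rewrite /x' A_lin linear_op0 // inner_axpyl //; last exact: A_l2.
by rewrite inner0l // addr0 !partsE /= => e; rewrite -[RHS]e; ring.
Qed.

(** The component y = A x - P A x in ker P is orthogonal to A x by [form_orthogonal] and to P A x by
    the symmetry of P, hence to itself. *)
Lemma range_invariant x : l2 x -> P x = x -> P (A x) = A x.
Proof.
move=> hx Px; have hAx := A_l2 hx; have hP := E_l2 measurable_negative hAx.
pose y := axpy (-1) (P (A x)) (A x).
have hy : l2 y by exact: l2_axpy.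
have Py : P y = fun=> 0.
  by rewrite /y E_axpy // ?E_idem // axpyN1.
have : y = fun=> 0.
  apply: inner_self_eq0 => //; rewrite {1}/y inner_axpyl //.
  rewrite form_orthogonal // addr0 E_sym //.
  by rewrite Py inner0r // mulr0.
by move/axpyN1_eq0.
Qed.

End SpectralProjection.

(** * Finite-dimensional negative spectrum *)

Section Eigenvectors.
Variable R : realType.
Local Notation C := R[i].
Implicit Types (x y : cseq R) (V : set (cseq R)) (A : operator R).

Lemma linear_op_lcomb A M c u : linear_op A ->
  A (lcomb M c u) = lcomb M c (fun i => A (u i)).
Proof.
by move=> Al; elim: M => [|M IH]; rewrite ?lcomb0 ?linear_op0 // !lcombS Al IH.
Qed.

Lemma lcomb_widen M N (c : nat -> C) (u : nat -> cseq R) : (M <= N)%N ->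
  (forall i, (M <= i)%N -> c i = 0) -> lcomb N c u = lcomb M c u.
Proof.
move=> MN h; apply/funext => k; rewrite /lcomb.
rewrite -!(big_mkord xpredT (fun i => c i * u i k)) (@big_cat_nat _ _ _ M 0 N) //=.
rewrite [X in _ + X]big_nat_cond [X in _ + X]big1 ?addr0 // => i.
by rewrite andbT => /andP[hi _]; rewrite h // mul0r.
Qed.

(** Here [w] is q(A) x, on which the factor X - r acts as A - r. *)
Lemma lcomb_mul_XsubC A x (q : {poly C}) (r : C) M : linear_op A ->
  (size q <= M)%N ->
  let w := lcomb M (fun i => q`_i) (fun i => iter i A x) in
  lcomb M.+1 (fun i => (q * ('X - r%:P))`_i) (fun i => iter i A x) =
  axpy (- r) w (A w).
Proof.
move=> Al qM w; rewrite /w linear_op_lcomb //.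
apply/funext => k; rewrite /axpy -[in RHS](@lcomb_widen M M.+1) //; last first.
  by move=> i hi; rewrite nth_default // (leq_trans qM).
rewrite /lcomb mulr_sumr.
have -> : \sum_(i < M) q`_i * A (iter i A x) k =
    \sum_(i < M.+1) (if i == 0%N :> nat then 0 else q`_i.-1) * iter i A x k.
  by rewrite big_ord_recl /= mul0r add0r.
rewrite -big_split /=; apply: eq_bigr => i _.
rewrite mulrBr coefB coefMX coefMC mulrBl mulNr mulrA [r * _]mulrC.
by rewrite addrC.
Qed.

(** Over C, p has a root r. With p = q (X - r) and p(A) x = 0, either q(A) x = 0, which lowers the
    degree, or q(A) x is an eigenvector for r. *)
Lemma eigenvector_of_annihilator A V x (p : {poly C}) : linear_op A ->
  linear_subspace V -> (forall y, V y -> V (A y)) -> V x -> x <> (fun=> 0) ->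
  p != 0 -> lcomb (size p) (fun i => p`_i) (fun i => iter i A x) = (fun=> 0) ->
  exists y lam, [/\ V y, y <> (fun=> 0) & A y = scale lam y].
Proof.
move=> Al sV VA Vx x0; move: {2}(size p) (leqnn (size p)) => n.
elim: n p => [|n IH] p hn p0 hp.
  by move: p0; rewrite -size_poly_leq0 hn.
have [p1|p1] := eqVneq (size p) 1%N.
  case: x0; apply/funext => k; have := congr1 (fun f => f k) hp.
  rewrite p1 /lcomb big_ord1 /= => /eqP; rewrite mulf_eq0 => /orP[|/eqP //].
  by have := p0; rewrite -lead_coef_eq0 lead_coefE p1 /= => /negbTE ->.
have [r /factor_theorem[q pq]] := closed_rootP p p1.
have q0 : q != 0 by apply: contraNneq p0 => q0; rewrite pq q0 mul0r.
have sp : size p = (size q).+1.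
  by rewrite pq size_Mmonic ?monicXsubC // size_XsubC addn2.
pose y := lcomb (size q) (fun i => q`_i) (fun i => iter i A x).
have [y0|y0] := pselect (y = fun=> 0); first by apply: (IH q) => //; rewrite -ltnS -sp.
exists y, r; split => //.
  apply: linear_subspace_lcomb => // i _.
  by elim: i => //= i; exact: VA.
apply/funext => k; have := congr1 (fun f => f k) hp.
rewrite sp pq lcomb_mul_XsubC // -/y /axpy /scale mulNr addrC.
by move=> /eqP; rewrite subr_eq0 => /eqP.
Qed.

(** The functionals embed V into C^N, so x, A x, ..., A^N x are linearly dependent; the relation is
    an annihilating polynomial. *)
Lemma exists_eigenvector A V N (f : nat -> cseq R -> C) x : linear_op A ->
  linear_subspace V -> (forall y, V y -> V (A y)) ->
  (forall j, (j < N)%N -> functional_on V (f j)) ->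
  (forall y, V y -> (forall j, (j < N)%N -> f j y = 0) -> y = fun=> 0) ->
  V x -> x <> (fun=> 0) ->
  exists y lam, [/\ V y, y <> (fun=> 0) & A y = scale lam y].
Proof.
move=> Al sV VA fl finj Vx x0.
have Vi i : V (iter i A x) by elim: i => //= i; exact: VA.
have [c [[i hi ci] hc]] := lcomb_kernel sV fl (fun i _ => Vi i) (ltnSn N).
have {}hc := finj _ (linear_subspace_lcomb _ sV (fun i _ => Vi i)) hc.
pose p : {poly C} := \poly_(i < N.+1) c i.
have pi j : (j < N.+1)%N -> p`_j = c j by move=> hj; rewrite coef_poly hj.
apply: (@eigenvector_of_annihilator A V x p) => //.
  by apply: contraNneq ci => p0; rewrite -pi // p0 coef0.
rewrite -[RHS]hc -(@lcomb_widen (size p) N.+1) ?size_poly //; last first.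
  by move=> j hj; rewrite nth_default.
by apply/funext => k; apply: eq_bigr => -[j hj] _ /=; rewrite pi.
Qed.

End Eigenvectors.

(** * Eigenbasis of ran P, its trace, and the negative eigenvalues *)

Section NegativeSpectrum.
Variable R : realType.
Local Notation C := R[i].
Variables (A : operator R) (E : set R -> operator R).
Hypothesis A_l2 : forall x, l2 x -> l2 (A x).
Hypothesis A_lin : linear_op A.
Hypothesis A_sym : forall x y, l2 x -> l2 y -> inner (A x) y = inner x (A y).
Hypothesis E_spec : spectral_measure A E.
Implicit Types (x y : cseq R).

Local Notation P := (E `]-oo, 0[%classic).

(** The data of the min-max principle: [f] bounds the rank of P by N from above, [G] from below. *)
Variables (N : nat) (f : nat -> cseq R -> C) (G : operator R).
Hypothesis f_lin : forall j, (j < N)%N -> functional_on (@l2 R) (f j).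
Hypothesis f_ge0 : forall x, l2 x -> (forall j, (j < N)%N -> f j x = 0) ->
  0 <= complex.Re (inner (A x) x).
Hypothesis G_lin : linear_op G.
Hypothesis G_l2 : forall c, l2 (G c).
Hypothesis G_lt0 : forall (c : cseq R) j, (j < N)%N -> c j != 0 ->
  complex.Re (inner (A (G c)) (G c)) < 0.
Hypothesis A_geom_simple : forall (lam : C) x y, A x = scale lam x ->
  A y = scale lam y -> x <> (fun=> 0) -> exists c, y = scale c x.

Definition ranP : set (cseq R) := [set x | l2 x /\ P x = x].

Lemma P_linear a x y : l2 x -> l2 y -> P (axpy a x y) = axpy a (P x) (P y).
Proof. exact: (E_axpy E_spec a (@measurable_negative R)). Qed.

Lemma P_l2 x : l2 x -> l2 (P x).
Proof. exact: (E_l2 E_spec (@measurable_negative R)). Qed.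

Lemma ranP_linear_subspace : linear_subspace ranP.
Proof.
have [h0 hl] := l2_linear_subspace R.
have P0 := E0 E_spec (@measurable_negative R).
split; first by split.
by move=> a x y [hx Px] [hy Py]; split; [exact: hl|rewrite P_linear // Px Py].
Qed.

Lemma ranP_l2 x : ranP x -> l2 x. Proof. by case. Qed.

Lemma ranP_inj x : ranP x -> (forall j, (j < N)%N -> f j x = 0) -> x = fun=> 0.
Proof.
move=> [hx Px] fx; apply: contrapT => /(form_lt0 E_spec hx Px).
by rewrite ltNge f_ge0.
Qed.

Definition eigensystem M (u : nat -> cseq R) (lam : nat -> C) :=
  [/\ forall i, (i < M)%N -> ranP (u i),
      forall i, (i < M)%N -> A (u i) = scale (lam i) (u i) &
      forall i j, (i < M)%N -> (j < M)%N -> inner (u i) (u j) = (i == j)%:R].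

Lemma inner_lcomb_eigensystem M u lam c i : eigensystem M u lam -> (i < M)%N ->
  inner (lcomb M c u) (u i) = c i.
Proof.
move=> [h1 h2 h3] hi.
have hl := inner_functional (ranP_l2 (h1 i hi)).
rewrite (functional_on_lcomb _ (l2_linear_subspace R) hl) //; last first.
  by move=> j hj; exact: ranP_l2 (h1 j hj).
rewrite (bigD1 (Ordinal hi)) //= h3 // eqxx mulr1 big1 ?addr0 // => j hj.
rewrite h3 //.
suff -> : (j == i :> nat) = false by rewrite mulr0.
by apply/negbTE; apply: contraNneq hj => e; apply/eqP/val_inj.
Qed.

(** N + 1 vectors would have a nonzero combination killed by all [f j]; there the form is
    nonnegative, whereas on ran P it is negative. *)
Lemma eigensystem_size M u lam : eigensystem M u lam -> (M <= N)%N.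
Proof.
move=> eu; have [h1 h2 h3] := eu; rewrite leqNgt; apply/negP => NM.
have fl j : (j < N)%N -> functional_on ranP (f j).
  by move=> hj a x y [hx _] [hy _]; exact: f_lin.
have [c [[i hi ci] hc]] := lcomb_kernel ranP_linear_subspace fl h1 NM.
have := ranP_inj (linear_subspace_lcomb _ ranP_linear_subspace h1) hc.
move=> /(congr1 (fun x => inner x (u i))); rewrite (inner_lcomb_eigensystem _ eu) //.
rewrite inner0l; last exact: ranP_l2 (h1 i hi).
by apply/eqP.
Qed.

(** The orthogonal complement of the system within ran P is invariant because A is symmetric and the
    u_i are eigenvectors; it therefore contains a further eigenvector, which is normalized. *)
Lemma eigensystem_extend M u lam x : eigensystem M u lam -> ranP x ->
  (forall i, (i < M)%N -> inner x (u i) = 0) -> x <> (fun=> 0) ->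
  exists u' lam', eigensystem M.+1 u' lam'.
Proof.
move=> [h1 h2 h3] rx ox x0.
pose V : set (cseq R) := [set y | ranP y /\ forall i, (i < M)%N -> inner y (u i) = 0].
have sV : linear_subspace V.
  have [r0 rl] := ranP_linear_subspace; split.
    by split => // i hi; rewrite inner0l //; exact: ranP_l2 (h1 i hi).
  move=> a y z [ry oy] [rz oz]; split; first exact: rl.
  move=> i hi; rewrite inner_axpyl ?oy ?oz ?mulr0 ?addr0 //; try exact: ranP_l2.
  exact: ranP_l2 (h1 i hi).
have VA y : V y -> V (A y).
  move=> [[hy Py] oy]; split.
    by split; [exact: A_l2|exact: (range_invariant A_l2 A_lin A_sym E_spec)].
  move=> i hi; have hu := ranP_l2 (h1 i hi).
  rewrite A_sym // h2 // -axpy0 inner_axpyr //; last exact: (l2_linear_subspace R).1.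
  by rewrite oy // mulr0 add0r inner0r.
have fl j : (j < N)%N -> functional_on V (f j).
  by move=> hj a y z [[hy _] _] [[hz _] _]; exact: f_lin.
have [] := exists_eigenvector A_lin sV VA fl _ (conj rx ox) x0.
  by move=> y [ry _]; exact: ranP_inj.
move=> y [l [[ry oy] y0 Ay]].
have hy := ranP_l2 ry.
pose s := complex.Re (inner y y); have s0 : 0 < s by exact: inner_self_gt0.
pose b := (Num.sqrt s)^-1; pose a : C := b%:C.
have [h0 _] := l2_linear_subspace R.
have hb : b * b * s = 1.
  by rewrite -invfM -expr2 sqr_sqrtr ?ltW // mulVf // gt_eqF.
have ha : a * a^* * s%:C = 1.
  apply: complex_ext; rewrite /a !partsE /=; last by ring.
  by rewrite -[RHS]hb; ring.
have ry' : ranP (scale a y).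
  by rewrite -axpy0; apply: (proj2 ranP_linear_subspace) => //;
    exact: (proj1 ranP_linear_subspace).
have inner_y' z : l2 z -> inner (scale a y) z = a * inner y z.
  by move=> hz; rewrite -axpy0 inner_axpyl // inner0l // addr0.
exists (fun i => if i == M then scale a y else u i).
exists (fun i => if i == M then l else lam i); split.
- by move=> i; rewrite ltnS leq_eqVlt; case: eqP => //= _; exact: h1.
- move=> i; rewrite ltnS leq_eqVlt; case: eqP => //= _; last exact: h2.
  move=> _; rewrite -[in LHS]axpy0 A_lin linear_op0 // Ay axpy0.
  by apply/funext => k; rewrite /scale mulrCA.
- move=> i j; rewrite 2!ltnS [(i <= M)%N]leq_eqVlt [(j <= M)%N]leq_eqVlt.
  case: (eqVneq i M) => [->|iM] /=; case: (eqVneq j M) => [->|jM] //= hi hj.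
  + rewrite ?eqxx inner_y'; last exact: ranP_l2.
    rewrite -axpy0 inner_axpyr // inner0r // addr0 inner_real // -/s.
    by rewrite mulrA ha.
  + rewrite inner_y'; last exact: ranP_l2 (h1 j hj).
    by rewrite oy // mulr0.
  + rewrite (inner_conj (x := scale a y)); [|exact: ranP_l2|exact: ranP_l2 (h1 i hi)].
    rewrite inner_y'; last exact: ranP_l2 (h1 i hi).
    by rewrite oy // mulr0 rmorph0 (negbTE iM).
  + by rewrite h3.
Qed.

(** Otherwise extensions would lead to N + 1 vectors, more than [eigensystem_size] permits. *)
Lemma maximal_eigensystem : exists M u lam, eigensystem M u lam /\
  forall x, ranP x -> (forall i, (i < M)%N -> inner x (u i) = 0) -> x = fun=> 0.
Proof.
apply: contrapT => nomax.
have all M : exists u lam, eigensystem M u lam.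
  elim: M => [|M [u [lam eu]]]; first by exists (fun=> fun=> 0), (fun=> 0); split.
  have [x] : exists x, [/\ ranP x, forall i, (i < M)%N -> inner x (u i) = 0 &
      x <> (fun=> 0)].
    apply: contrapT => nox; apply: nomax; exists M, u, lam; split => // x rx ox.
    by apply: contrapT => x0; apply: nox; exists x.
  by case=> rx ox x0; exact: eigensystem_extend eu rx ox x0.
have [u [lam /eigensystem_size]] := all N.+1.
by rewrite ltnn.
Qed.

(** The difference of the two sides lies in ran P and is orthogonal to the system, hence is zero. *)
Lemma proj_eigensystem M u lam x : eigensystem M u lam ->
  (forall x, ranP x -> (forall i, (i < M)%N -> inner x (u i) = 0) -> x = fun=> 0) ->
  l2 x -> P x = lcomb M (fun i => inner x (u i)) u.
Proof.
move=> eu umax hx; have [h1 h2 h3] := eu.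
have rL := linear_subspace_lcomb (fun i => inner x (u i)) ranP_linear_subspace h1.
have rP : ranP (P x).
  by split; [exact: P_l2|exact: (E_idem E_spec (@measurable_negative R))].
apply/axpyN1_eq0/umax => [|i hi]; first exact: (proj2 ranP_linear_subspace).
have [hu Pu] := h1 i hi.
rewrite inner_axpyl ?(inner_lcomb_eigensystem _ eu) //; try exact: ranP_l2.
by rewrite (E_sym E_spec (@measurable_negative R)) // Pu mulN1r addNr.
Qed.

(** For M < N some c with a nonzero entry among the first N makes G c orthogonal to all u_j. Then P
    (G c) = 0 and the form is nonnegative at G c, against [G_lt0]. *)
Lemma eigenbasis : exists u lam, eigensystem N u lam /\
  forall x, l2 x -> P x = lcomb N (fun i => inner x (u i)) u.
Proof.
have [M [u [lam [eu umax]]]] := maximal_eigensystem.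
have [h1 h2 h3] := eu.
suff MN : M = N.
  by rewrite -MN; exists u, lam; split => // x; exact: proj_eigensystem eu umax.
apply/eqP; rewrite eqn_leq (eigensystem_size eu) leqNgt; apply/negP => MN.
have fl j : (j < M)%N -> functional_on setT (fun c => inner (G c) (u j)).
  move=> hj a x y _ _; rewrite G_lin inner_axpyl //.
  exact: ranP_l2 (h1 j hj).
(* The vectors here are coefficient sequences; [w] below is [c] cut off at N. *)
have [c [[i hi ci] hc]] := lcomb_kernel (u := basis_vec R)
  (linear_subspaceT R) fl (fun i _ => I) MN.
set w := lcomb N c _ in hc.
have wi : w i != 0 by rewrite /w lcomb_basis hi.
have := G_lt0 hi wi; apply/negP; rewrite -leNgt.
apply: (form_ge0 E_spec) => //.
rewrite (proj_eigensystem eu umax) //; apply/funext => k; rewrite /lcomb.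
by apply: big1 => j _; rewrite hc // mul0r.
Qed.

(** Exchanging two nonnegative sums turns the trace into the sum of the N squared norms |u_i|^2 =
    1. *)
Lemma trace_eigenbasis : trace P = (N%:R)%:E.
Proof.
have [u [lam [[h1 h2 h3] hP]]] := eigenbasis.
have hu (i : 'I_N) := ranP_l2 (h1 i (ltn_ord i)).
rewrite /trace (eq_eseriesr (g := fun k =>
  (\sum_(i < N) (redot (u i k) (u i k))%:E)%E)); last first.
  move=> k _; rewrite sumEFin; congr EFin.
  have hk := l2_basis R k.
  rewrite inner_basis; last exact: P_l2.
  rewrite hP // /lcomb (big_morph (@complex.Re R) (@ReD R) (erefl _)).
  apply: eq_bigr => i _; rewrite (inner_conj (x := u i)) // inner_basis //.
  by rewrite /redot !partsE; ring.
rewrite nneseries_sum; last by move=> i k _; rewrite lee_fin redot_ge0.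
rewrite (eq_bigr (fun=> 1%E)).
  by rewrite sumEFin big_const_ord iter_addr addr0.
move=> i _; have [+ _] := l2_inner (hu i) (hu i).
rewrite h3 // eqxx (_ : (fun k => _) = (fun k => redot (u i k) (u i k))); last first.
  by apply/funext => k; rewrite Re_innerE.
move=> h; apply: cvg_lim => //.
rewrite (_ : (fun n => _) = EFin \o series (fun k => redot (u i k) (u i k))).
  by apply: cvg_EFin; [exact: nearW|exact: h].
by apply/funext => n; rewrite /series /= sumEFin.
Qed.

Lemma negative_eigenvalues : exactly_simple_negative_eigenvalues A N.
Proof.
have [u [lam [eu hP]]] := eigenbasis; have [h1 h2 h3] := eu.
have [h0 _] := l2_linear_subspace R.
have u0 i : (i < N)%N -> u i <> (fun=> 0).
  move=> hi ui; have := h3 i i hi hi; rewrite {1}ui inner0l ?eqxx.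
    by move=> /esym/eqP; rewrite oner_eq0.
  exact: ranP_l2 (h1 i hi).
have lamE i : (i < N)%N -> lam i = inner (A (u i)) (u i).
  move=> hi; have hu := ranP_l2 (h1 i hi).
  by rewrite h2 // -axpy0 inner_axpyl // inner0l // h3 // eqxx mulr1 addr0.
have lam_real i : (i < N)%N -> (complex.Re (lam i))%:C = lam i.
  move=> hi; have hu := ranP_l2 (h1 i hi).
  apply: complex_ext => //=; have := inner_conj (A_l2 hu) hu.
  rewrite -A_sym // -lamE // => /(congr1 (@complex.Im R)); rewrite ImJ => e.
  by apply/esym/eqP; rewrite -eqNr -e.
have lam_lt0 i : (i < N)%N -> complex.Re (lam i) < 0.
  move=> hi; have [hu Pu] := h1 i hi; rewrite lamE //.
  exact: (form_lt0 E_spec hu Pu (u0 i hi)).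
split; last first.
  move=> l _ [psi [hpsi Apsi] psi0]; exists psi; split => // phi [hphi Aphi].
  exact: (A_geom_simple Apsi Aphi psi0).
have -> : [set l : R | l < 0 /\ l2_eigenvalue A l%:C] =
    (fun i => complex.Re (lam i)) @` `I_N.
  apply/seteqP; split => [l [l0 [psi [hpsi Apsi] psi0]]|_ [i hi <-]]; last first.
    split; first exact: lam_lt0.
    exists (u i); last exact: u0.
    by split; [exact: ranP_l2 (h1 i hi)|rewrite lam_real // h2].
  (* An eigenvector for a further l < 0 is orthogonal to all u_i, hence in ker P, where the form is
     nonnegative; but its value is l |psi|^2 < 0. *)
  apply: contrapT => nl.
  have ortho i : (i < N)%N -> inner psi (u i) = 0.
    move=> hi; have hu := ranP_l2 (h1 i hi).
    have := A_sym hpsi hu; rewrite Apsi h2 //.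
    rewrite -/(scale l%:C psi) -!axpy0 inner_axpyl // inner_axpyr //.
    rewrite inner0l // inner0r // !addr0 => /eqP; rewrite -subr_eq0 -mulrBl mulf_eq0.
    case/orP => /eqP // e; case: nl; exists i => //.
    have := congr1 (@complex.Re R) e; rewrite !partsE /= => {}e.
    by apply/eqP; rewrite eq_sym -subr_eq0 e.
  have Ppsi : P psi = fun=> 0.
    by rewrite hP //; apply/funext => k; apply: big1 => i _; rewrite ortho // mul0r.
  have := form_ge0 E_spec hpsi Ppsi; apply/negP; rewrite -ltNge Apsi.
  rewrite -/(scale l%:C psi) -axpy0 inner_axpyl // inner0l // addr0 inner_real //.
  by rewrite !partsE /= mulr0 subr0 nmulr_rlt0 // inner_self_gt0.
(* Equal eigenvalues would make u_i and u_j proportional by simplicity, although they are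
   orthonormal. *)
apply: inj_card_eq => i j /set_mem hi /set_mem hj e.
have lij : lam i = lam j by rewrite -lam_real // e lam_real.
apply: contrapT => ij.
have Aj := h2 j hj; rewrite -lij in Aj.
have [c hc] := A_geom_simple (h2 i hi) Aj (u0 i hi).
have hui := ranP_l2 (h1 i hi).
have := h3 j i hj hi; rewrite hc -axpy0 inner_axpyl // inner0l // addr0 h3 //.
rewrite eqxx mulr1 [j == i](introF eqP) => [c0|]; last by move=> h; apply: ij.
by case: (u0 j hj); rewrite hc c0; apply/funext => k; rewrite /scale mul0r.
Qed.

End NegativeSpectrum.

(** * Stability of the negative index *)

Section MorseIndex.
Variable R : realType.
Local Notation C := R[i].
Implicit Types (d s : nat -> R) (x y : cseq R).

Lemma sign_gap s n : exists2 g, 0 < g & forall i, (i < n)%N -> s i != 0 -> g <= `|s i|.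
Proof.
elim: n => [|n [g g0 IH]]; first by exists 1.
have [s0|s0] := eqVneq (s n) 0.
  exists g => // i; rewrite ltnS leq_eqVlt => /orP[/eqP ->|hi]; last exact: IH.
  by rewrite s0 eqxx.
exists (Num.min g `|s n|); first by rewrite lt_min g0 normr_gt0.
move=> i; rewrite ltnS leq_eqVlt => /orP[/eqP -> _|hi si].
  by rewrite ge_min lexx orbT.
by rewrite ge_min IH.
Qed.

Lemma Jform_perturb d d' n x (del : R) :
  (forall k, (k < n)%N -> `|d' k - d k| <= del) ->
  `|Jform d' n x - Jform d n x| <= del * \sum_(i < n) redot (x i) (x i).
Proof.
move=> h; rewrite /Jform -sumrB mulr_sumr.
apply: le_trans (ler_norm_sum _ _ _) _; apply: ler_sum => -[i hi] _ /=.
rewrite (_ : _ - _ = (d' i - d i) * redot (x i) (x i)); last by ring.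
by rewrite normrM (ger0_norm (redot_ge0 _)) ler_wpM2r ?redot_ge0 // h.
Qed.

(* The margin e is what is spent on the tail of a finitely supported extension
   of the vectors G c. *)
Definition morse_index n (q : cseq R -> R) N e :=
  exists (f : nat -> cseq R -> C) (G : operator R),
  [/\ forall j, functional_on setT (f j),
      forall x, (forall j, (j < N)%N -> f j x = 0) -> 0 <= q x,
      linear_op G &
      forall (c : cseq R) j, (j < N)%N -> c j != 0 ->
        q (G c) + e * redot (G c n) (G c n) < 0].

(** The functionals read the coordinates with negative coefficient; [G] prescribes these and sets
    the others to 0. The error is at most del c |T x|^2: nonnegative coefficients absorb it by
    [hpos], and on the range of [G] the gap g exceeds it together with the margin e. *)
Lemma morse_index_perturb n (q q' : cseq R -> R) s T Ti (c g e del : R) :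
  diagonalizes n.+1 q s T Ti c ->
  (forall i, (i < n.+1)%N -> s i < 0 -> s i <= - g) ->
  (forall i, (i < n.+1)%N -> 0 <= s i -> del * c <= s i) ->
  0 <= del -> 0 <= e -> (del + e) * c < g ->
  (forall x, `|q' x - q x| <= del * \sum_(i < n.+1) redot (x i) (x i)) ->
  morse_index n q' (size (negs n.+1 s)) e.
Proof.
move=> [Tl Til TTi _ Tq c0 Tb] hneg hpos del0 e0 hg hq.
set N := negs n.+1 s.
pose f j x := T x (nth 0%N N j).
pose spread (w : cseq R) : cseq R := fun k => if k \in N then w (index k N) else 0.
have sl : linear_op spread.
  move=> a x y; apply/funext => k; rewrite /spread /axpy; case: ifP => // _.
  by rewrite mulr0 addr0.
exists f, (fun w => Ti (spread w)); split.
- by move=> j a x y _ _; rewrite /f Tl.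
- move=> x fx.
  have := hq x; rewrite ler_norml => /andP[+ _].
  have := ler_wpM2l del0 (Tb x).
  suff : del * (c * \sum_(i < n.+1) redot (T x i) (T x i)) <= q x by lra.
  rewrite Tq mulrA mulr_sumr; apply: ler_sum => -[i hi] _ /=.
  have [si|si] := ltP (s i) 0; last by rewrite ler_wpM2r ?redot_ge0 // hpos.
  have iN : i \in N by rewrite mem_negs hi.
  have -> : T x i = 0 by rewrite -(nth_index 0%N iN); apply: fx; rewrite index_mem.
  by rewrite /redot /= !mulr0 addr0 !mulr0.
- by move=> a x y; rewrite sl Til.
move=> w j hj wj; set x := Ti (spread w).
have Tx : T x = spread w by rewrite /x TTi.
pose S := \sum_(i < n.+1) redot (spread w i) (spread w i).
have S0 : 0 < S.
  have jN : nth 0%N N j \in N by rewrite mem_nth.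
  have jn : (nth 0%N N j < n.+1)%N by move: jN; rewrite mem_negs => /andP[].
  rewrite /S (bigD1 (Ordinal jn)) //= ltr_pwDl //; last first.
    by apply: sumr_ge0 => i _; exact: redot_ge0.
  by apply: redot_gt0; rewrite /spread jN index_uniq // negs_uniq.
have hS := Tb x; rewrite Tx -/S in hS.
have q1 : q x <= - g * S.
  rewrite Tq Tx mulr_sumr; apply: ler_sum => -[i hi] _ /=.
  rewrite /spread; case: ifP => [|_]; last by rewrite /redot /= !mulr0 addr0 !mulr0.
  by rewrite mem_negs => /andP[_ si]; rewrite ler_wpM2r ?redot_ge0 // hneg.
have q2 : q' x <= q x + del * \sum_(i < n.+1) redot (x i) (x i).
  by have := hq x; rewrite ler_norml => /andP[_]; rewrite lerBlDl.
have xn : redot (x n) (x n) <= \sum_(i < n.+1) redot (x i) (x i).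
  rewrite big_ord_recr /= lerDr; apply: sumr_ge0 => i _; exact: redot_ge0.
have h1 := ler_wpM2l del0 hS.
have h2 := ler_wpM2l e0 (le_trans xn hS).
have h3 : (del + e) * c * S < g * S by rewrite ltr_pM2r.
by lra.
Qed.

(** Applied with del = 0, so that coefficients equal to 0 are admissible. The choice e = g / (c + 1)
    gives e c < g, also for c = 0. *)
Lemma morse_index_critical d n N : has_negative_index n.+1 (Jform d n.+1) N ->
  exists2 e, 0 < e & morse_index n (Jform d n.+1) N e.
Proof.
case=> s [T [Ti [c dT]]] <-; have [g g0 hg] := sign_gap s n.+1.
have c0 := diag_c dT.
have c1 : 0 < c + 1 by rewrite ltr_wpDl.
exists (g / (c + 1)); first by rewrite divr_gt0.
apply: (@morse_index_perturb n _ _ s T Ti c g _ 0 dT) => //.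
- by move=> i hi si; have := hg i hi (ltr0_neq0 si); rewrite ltr0_norm // lerNr.
- by move=> i _; rewrite mul0r.
- by rewrite divr_ge0 // ltW.
- by rewrite add0r mulrAC ltr_pdivrMr // ltr_pM2l // ltrDl.
- by move=> x; rewrite subrr normr0 mul0r.
Qed.

(** No coefficient vanishes, so all are at least g in absolute value; the gap is shared equally
    between the perturbation and the margin. *)
Lemma morse_index_stable d n : cont d n.+1 != 0 ->
  exists N (e del : R), [/\ 0 < e, 0 < del & forall d',
    (forall k, (k < n.+1)%N -> `|d' k - d k| <= del) ->
    morse_index n (Jform d' n.+1) N e].
Proof.
move=> /diagonal_form_nondegenerate[s [T [Ti [c dT]]] s0].
have [g g0 hg] := sign_gap s n.+1.
have c0 := diag_c dT.
have c1 : 0 < c + 1 by rewrite ltr_wpDl.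
pose e := g / (2 * (c + 1)).
have e0 : 0 < e by rewrite divr_gt0 // mulr_gt0.
have ec : (e + e) * c < g.
  rewrite /e (_ : _ * c = g * c / (c + 1)); last by field; rewrite gt_eqF.
  by rewrite ltr_pdivrMr // ltr_pM2l // ltrDl.
have ec0 : 0 <= e * c by rewrite mulr_ge0 // ltW.
exists (size (negs n.+1 s)), e, e; split => // d' hd'.
apply: (@morse_index_perturb n _ _ s T Ti c g e e dT) => //; try exact: ltW.
- by move=> i hi si; have := hg i hi (s0 i hi); rewrite ltr0_norm // lerNr.
- move=> i hi si; have := hg i hi (s0 i hi); rewrite ger0_norm // => /(le_trans _); apply.
  by lra.
- by move=> x; exact: Jform_perturb.
Qed.

End MorseIndex.

(** * The operator H_mu *)

Section JacobiOperator.
Variable R : realType.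
Local Notation C := R[i].
Variables (m : nat) (mu : 'rV[R]_m.+1).
Implicit Types (x y : cseq R).

Local Notation H := (H_op mu).

Definition pot k : R := if k == 0%N then 2 * entry mu 0 else entry mu k.

Definition poffdiag k : R := if k is j.+1 then offdiag R j else 0.

Lemma H_opE x k : H x k = (poffdiag k)%:C * pred_term x k +
  (2 + pot k)%:C * x k + (offdiag R k)%:C * x k.+1.
Proof.
rewrite /H_op /free_jacobi /potential -[if _ then _ else _]/(pot k).
have -> : (2 + pot k)%:C = 2 + (pot k)%:C :> C by rewrite rmorphD rmorph_nat.
by case: k => [|k] /=; rewrite ?mul0r ?mulr0; ring.
Qed.

Lemma entry_out k : (m < k)%N -> entry mu k = 0.
Proof. by move=> hk; rewrite /entry insubF // ltnNge hk. Qed.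

Lemma H_linear : linear_op H.
Proof.
move=> a x y; apply/funext => k; rewrite {2}/axpy !H_opE.
have -> : pred_term (axpy a x y) k = a * pred_term x k + pred_term y k.
  by case: k => [|k] //=; rewrite mulr0 addr0.
by rewrite /axpy; ring.
Qed.

Lemma offdiag_neq0 k : offdiag R k != 0.
Proof.
rewrite /offdiag; case: ifP => _; last by rewrite oppr_eq0 oner_eq0.
by rewrite oppr_eq0 sqrtr_eq0 -ltNge.
Qed.

(** The off-diagonal entries are nonzero, so the three-term recursion determines a solution from its
    first entry. *)
Lemma H_initial_value (lam : C) x : H x = scale lam x -> x 0%N = 0 -> x = fun=> 0.
Proof.
move=> Hx x0; apply/funext => k.
suff [] : x k = 0 /\ x k.+1 = 0 by [].
have step j : pred_term x j = 0 -> x j = 0 -> x j.+1 = 0.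
  move=> h1 h2; have := congr1 (fun f => f j) Hx.
  rewrite H_opE h1 /scale h2 !mulr0 !add0r => /eqP; rewrite mulf_eq0.
  move=> /orP[|/eqP //]; rewrite (fmorph_eq0 (real_complex R)).
  by rewrite (negbTE (offdiag_neq0 j)).
elim: k => [|k [h1 h2]]; first by split=> //; exact: (step 0%N).
by split=> //; exact: (step k.+1).
Qed.

Lemma H_geom_simple (lam : C) x y : H x = scale lam x -> H y = scale lam y ->
  x <> (fun=> 0) -> exists c, y = scale c x.
Proof.
move=> Hx Hy x0.
have xn : x 0%N != 0.
  by apply/eqP => xn; apply: x0; exact: H_initial_value Hx xn.
exists (y 0%N / x 0%N).
have : axpy (- (y 0%N / x 0%N)) x y = fun=> 0.
  apply: (@H_initial_value lam).
    rewrite H_linear Hx Hy; apply/funext => k; rewrite /axpy /scale; ring.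
  by rewrite /axpy mulNr divfK // addNr.
move=> h; apply/funext => k; have := congr1 (fun f => f k) h.
by rewrite /axpy /scale mulNr addrC => /eqP; rewrite subr_eq0 => /eqP.
Qed.

Lemma l2_mul (b : nat -> R) (B : R) x : (forall k, b k ^+ 2 <= B) -> l2 x ->
  l2 (fun k => (b k)%:C * x k).
Proof.
move=> hb /l2P[M hM]; apply/l2P; exists (B * M) => n.
have B0 : 0 <= B by apply: le_trans (hb 0%N); exact: sqr_ge0.
apply: le_trans (ler_wpM2l B0 (hM n)).
rewrite mulr_sumr; apply: ler_sum => k _; rewrite redotM ler_wpM2r ?redot_ge0 //.
by rewrite /redot /= mulr0 addr0 -expr2.
Qed.

Lemma offdiag_sqr_le k : offdiag R k ^+ 2 <= 2.
Proof.
rewrite /offdiag; case: ifP => _; rewrite sqrrN ?sqr_sqrtr // expr1n.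
by rewrite ler1n.
Qed.

Lemma pot_bounded : exists B : R, forall k, (2 + pot k) ^+ 2 <= B.
Proof.
exists (4 + \sum_(i < m.+1) (2 + pot i) ^+ 2) => k.
have [hk|hk] := leqP k m.
  have hk' : (k < m.+1)%N by [].
  rewrite (bigD1 (Ordinal hk')) //= addrCA lerDl addr_ge0 // sumr_ge0 // => i _.
  exact: sqr_ge0.
rewrite /pot (gtn_eqF (leq_ltn_trans (leq0n m) hk)) entry_out // addr0.
rewrite (_ : 2 ^+ 2 = 4 :> R) ?lerDl ?sumr_ge0 // => [i _|]; first exact: sqr_ge0.
by rewrite -natrX.
Qed.

Lemma H_l2 x : l2 x -> l2 (H x).
Proof.
move=> hx; have [B hB] := pot_bounded.
have h1 : l2 (fun k => (poffdiag k)%:C * pred_term x k).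
  apply: (@l2_mul _ 2); last exact: l2_unshift.
  by case=> [|k]; [rewrite /= expr0n|exact: offdiag_sqr_le].
have h2 : l2 (fun k => (2 + pot k)%:C * x k) by exact: (@l2_mul _ B).
have h3 : l2 (fun k => (offdiag R k)%:C * x k.+1).
  by apply: (@l2_mul _ 2 (fun k => x k.+1)); [exact: offdiag_sqr_le|exact: l2_shift].
have := l2_axpy 1 (l2_axpy 1 h1 h2) h3.
congr l2; apply/funext => k; rewrite H_opE /axpy !mul1r //.
Qed.

(** Discrete Lagrange identity: the sum telescopes to a Wronskian at the end, which tends to 0 for
    square-summable sequences. *)
Lemma H_lagrange x y n :
  \sum_(k < n) (redot (H x k) (y k) - redot (x k) (H y k)) =
  poffdiag n * (redot (x n) (pred_term y n) - redot (pred_term x n) (y n)).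
Proof.
elim: n => [|n IH]; first by rewrite big_ord0 mul0r.
rewrite big_ord_recr /= IH !H_opE /= /redot !partsE /=; ring.
Qed.

Lemma H_symm_Re x y : l2 x -> l2 y ->
  complex.Re (inner (H x) y) = complex.Re (inner x (H y)).
Proof.
move=> hx hy; have [h1 _] := l2_inner (H_l2 hx) hy.
have [h2 _] := l2_inner hx (H_l2 hy).
set S1 := series _ in h1; set S2 := series _ in h2.
have h : (S1 n - S2 n) @[n --> \oo] -->
    complex.Re (inner (H x) y) - complex.Re (inner x (H y)) by exact: cvgB h1 h2.
apply/eqP; rewrite -subr_eq0; apply/eqP.
rewrite -(cvg_lim (@Rhausdorff R) h); apply: cvg_lim => //.
have hb n : `|poffdiag n * (redot (x n) (pred_term y n) - redot (pred_term x n) (y n))| <=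
    2 * (redot (x n) (x n) + redot (pred_term y n) (pred_term y n) +
         (redot (pred_term x n) (pred_term x n) + redot (y n) (y n))).
  rewrite normrM ler_pM //.
    case: n => [|n]; first by rewrite normr0.
    rewrite -(@ler_pXn2r _ 2) ?nnegrE // real_normK ?num_real //.
    by apply: le_trans (offdiag_sqr_le n) _; rewrite -natrX ler_nat.
  by apply: le_trans (ler_normB _ _) _; rewrite lerD // redot_le.
have z1 := l2_redot0 hx; have z2 := l2_redot0 hy.
have z3 := l2_redot0 (l2_unshift hx); have z4 := l2_redot0 (l2_unshift hy).
apply: (@squeeze_cvgr _ _ _ _
  (fun n => - (2 * (redot (x n) (x n) + redot (pred_term y n) (pred_term y n) +
         (redot (pred_term x n) (pred_term x n) + redot (y n) (y n)))))
  (fun n => 2 * (redot (x n) (x n) + redot (pred_term y n) (pred_term y n) +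
         (redot (pred_term x n) (pred_term x n) + redot (y n) (y n))))).
- apply: nearW => n; rewrite -ler_norml.
  apply: le_trans (hb n); rewrite -H_lagrange sumrB le_eqVlt.
  apply/orP; left; apply/eqP; rewrite /S1 /S2 /series /= !big_mkord.
  congr (`| _ - _ |); apply: eq_bigr => k _.
    by rewrite Re_innerE.
  by rewrite Re_innerE.
- rewrite -[X in _ --> X]oppr0; apply: cvgN.
  rewrite -[X in _ --> X](mulr0 2) -[X in _ * X](addr0 0).
  rewrite -[X in _ * (X + _)](addr0 0) -[X in _ * (_ + X)](addr0 0).
  by apply: cvgMl_tmp; apply: cvgD; exact: cvgD.
- rewrite -[X in _ --> X](mulr0 2) -[X in _ * X](addr0 0).
  rewrite -[X in _ * (X + _)](addr0 0) -[X in _ * (_ + X)](addr0 0).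
  by apply: cvgMl_tmp; apply: cvgD; exact: cvgD.
Qed.

Lemma H_symm x y : l2 x -> l2 y -> inner (H x) y = inner x (H y).
Proof.
move=> hx hy; apply: complex_ext; first exact: H_symm_Re.
have hHx := H_l2 hx; have hHy := H_l2 hy.
have [h0 _] := l2_linear_subspace R.
pose x' := scale (-'i%C) x.
have hx' : l2 x' by rewrite /x' -axpy0; exact: l2_axpy.
have := H_symm_Re hx' hy.
rewrite /x' -axpy0 H_linear (linear_op0 H_linear) !inner_axpyl // !inner0l //.
rewrite !addr0 !partsE /=; lra.
Qed.

(** * Splitting the form of H_mu into a finite block and a free tail *)

Definition rescale x : cseq R :=
  fun k => if k == 0%N then (Num.sqrt 2)%:C * x 0%N else x k.

Definition unrescale x : cseq R :=
  fun k => if k == 0%N then (Num.sqrt 2)^-1%:C * x 0%N else x k.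

Lemma sqrt2_sqr : Num.sqrt (2 : R) * Num.sqrt 2 = 2.
Proof. by rewrite -expr2 sqr_sqrtr. Qed.

Lemma sqrt2_neq0 : Num.sqrt (2 : R) != 0.
Proof. by rewrite sqrtr_eq0 -ltNge. Qed.

Lemma unrescaleK x : rescale (unrescale x) = x.
Proof.
apply/funext => k; rewrite /rescale /unrescale eqxx; case: eqP => // ->.
by rewrite mulrA -rmorphM /= mulfV ?sqrt2_neq0 // rmorph1 mul1r.
Qed.

(** The boundary term is there because row n - 1 contains x_n, while [Jform] stops at x_(n-1). *)
Lemma H_partial_form x n :
  \sum_(k < n) redot (H x k) (x k) =
  Jform (free_diag mu) n (rescale x)
    - redot (rescale x n) (pred_term (rescale x) n).
Proof.
have s2 := sqrt2_sqr.
elim: n => [|n IH].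
  by rewrite big_ord0 /Jform big_ord0 /redot /= !mulr0 addr0 subr0.
rewrite big_ord_recr /= IH JformS H_opE /redot /free_diag /pot.
case: n {IH} => [|[|n]]; rewrite /rescale /= /offdiag /= !partsE /=.
- set r := Num.sqrt 2 in s2 *.
  rewrite -[X in X = _](subrK (complex.Re (x 0%N) ^+ 2 * 0)).
  have e (a b : R) : (r * a - 0 * b) * (r * a - 0 * b) = 2 * a ^+ 2.
    by rewrite -s2; ring.
  have e' (a b : R) : (r * a + 0 * b) * (r * a + 0 * b) = 2 * a ^+ 2.
    by rewrite -s2; ring.
  by rewrite !e !e'; ring.
- by ring.
- by ring.
Qed.

Definition threshold_diag k : R := free_diag mu k - (k == m)%:R.

(** By 2 |b|^2 - 2 Re (a conj b) = |a - b|^2 - |a|^2 + |b|^2, each free row adds a square and moves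
    the final term |y|^2 one place on; lowering the entry at m by 1 provides its first instance. *)
Lemma Jform_tail y j :
  Jform (free_diag mu) (m.+1 + j) y = Jform threshold_diag m.+1 y
  + \sum_(i < j) redot (y (m + i)%N - y (m + i).+1) (y (m + i)%N - y (m + i).+1)
  + redot (y (m + j)%N) (y (m + j)%N).
Proof.
elim: j => [|j IH].
  rewrite !addn0 big_ord0 addr0 !JformS.
  have -> : Jform threshold_diag m y = Jform (free_diag mu) m y.
    by apply: eq_Jform => // k hk; rewrite /threshold_diag ltn_eqF // subr0.
  by rewrite /threshold_diag eqxx [true%:R]mulr1n; ring.
rewrite addnS JformS IH big_ord_recr /= addnS.
have -> : free_diag mu (m + j).+1 = 2.
  by rewrite /free_diag /= entry_out ?addr0 // ltnS leq_addr.
by rewrite /redot !partsE; ring.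
Qed.

Lemma H_form_ge0 x : l2 x -> 0 <= Jform threshold_diag m.+1 (rescale x) ->
  0 <= complex.Re (inner (H x) x).
Proof.
move=> hx hJ; have [h1 _] := l2_inner (H_l2 hx) hx.
set S := series _ in h1.
(* Adding |x_n|^2, which tends to 0, keeps the limit and lets |y_(n-1)|^2 + |y_n|^2 absorb the
   boundary term, y being the rescaled x. *)
have h : (S n + redot (x n) (x n)) @[n --> \oo] --> complex.Re (inner (H x) x).
  by rewrite -[X in _ --> X]addr0; exact: cvgD h1 (l2_redot0 hx).
rewrite -(cvg_lim (@Rhausdorff R) h).
apply: limr_ge; first by apply/cvg_ex; exists (complex.Re (inner (H x) x)).
exists m.+1 => // n /= hn.
rewrite /S /series /= big_mkord.
under eq_bigr do rewrite Re_innerE.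
rewrite H_partial_form -(subnKC hn) Jform_tail; set j := (n - m.+1)%N.
rewrite addSn /=.
have -> : x (m + j).+1 = rescale x (m + j).+1 by [].
have := redot_le (rescale x (m + j).+1) (rescale x (m + j)%N).
rewrite ler_norml => /andP[_ h2].
have : 0 <= \sum_(i < j) redot (rescale x (m + i)%N - rescale x (m + i).+1)
    (rescale x (m + i)%N - rescale x (m + i).+1).
  by apply: sumr_ge0 => i _; exact: redot_ge0.
by lra.
Qed.

(** The entries up to y_m, followed by a linear descent from y_m to 0 at m + L. Truncated
    subtraction makes the factor 1 up to m and 0 from m + L on. *)
Definition ramp L y : cseq R :=
  fun k => ((L - (k - m))%:R / L%:R : R)%:C * y (minn k m).

Lemma ramp_head L y k : (0 < L)%N -> (k <= m)%N -> ramp L y k = y k.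
Proof.
move=> L0 hk; rewrite /ramp (eqP hk) subn0 divff ?rmorph1 ?mul1r.
  by rewrite (minn_idPl hk).
by rewrite pnatr_eq0 -lt0n.
Qed.

Lemma ramp_tail L y i : ramp L y (m + i)%N = ((L - i)%:R / L%:R)%:C * y m.
Proof. by rewrite /ramp addKn (minn_idPr (leq_addr _ _)). Qed.

Lemma ramp_out L y k : (m + L <= k)%N -> ramp L y k = 0.
Proof.
move=> hk; rewrite -(subnKC (leq_trans (leq_addr L m) hk)) ramp_tail.
suff -> : (L - (k - m) = 0)%N by rewrite mul0r mul0r.
by apply/eqP; rewrite subn_eq0 -(leq_add2l m) subnKC // (leq_trans (leq_addr L m)).
Qed.

Lemma ramp_linear L : linear_op (ramp L).
Proof. by move=> a x y; apply/funext => k; rewrite /ramp /axpy; ring. Qed.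

Lemma unrescale_linear : linear_op unrescale.
Proof.
by move=> a x y; apply/funext => k; rewrite /unrescale /axpy; case: eqP => _ //; ring.
Qed.

Lemma unrescale_ramp_out L y k : (0 < L)%N -> (m + L <= k)%N ->
  unrescale (ramp L y) k = 0.
Proof.
move=> L0 hk; rewrite /unrescale.
case: eqP => [k0|_]; last exact: ramp_out.
by move: hk L0; rewrite k0 leqn0 addn_eq0 => /andP[_ /eqP ->].
Qed.

Lemma unrescale_ramp_l2 L y : (0 < L)%N -> l2 (unrescale (ramp L y)).
Proof.
by move=> L0; apply: (@l2_finite _ _ (m + L)) => k hk; exact: unrescale_ramp_out.
Qed.

(** The descent has L steps of size |y_m| / L, whose squares add up to |y_m|^2 / L. *)
Lemma H_form_ramp L y : (0 < L)%N ->
  let x := unrescale (ramp L y) in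
  complex.Re (inner (H x) x) =
  Jform threshold_diag m.+1 y + L%:R^-1 * redot (y m) (y m).
Proof.
move=> L0 x; have hx : l2 x by exact: unrescale_ramp_l2.
have [h1 _] := l2_inner (H_l2 hx) hx.
rewrite -(cvg_lim (@Rhausdorff R) h1).
have x0 k : (m + L <= k)%N -> x k = 0 by exact: unrescale_ramp_out.
have Ln0 : L%:R != 0 :> R by rewrite pnatr_eq0 -lt0n.
apply: cvg_lim => //; apply: cvg_near_cst; exists (m.+1 + L)%N => // n /= hn.
rewrite /series /= (@big_cat_nat _ _ _ (m.+1 + L) 0 n) //= [X in _ + X]big_nat_cond.
rewrite [X in _ + X]big1 ?addr0; last first.
  move=> k; rewrite andbT => /andP[hk _]; rewrite Re_innerE x0.
    by rewrite /redot /= !mulr0 addr0.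
  by apply: leq_trans hk; rewrite addSn.
rewrite big_mkord; under eq_bigr do rewrite Re_innerE.
rewrite H_partial_form Jform_tail /x unrescaleK addSn /=.
rewrite (ramp_out _ (leqnn _)).
have d0 (z : C) : redot z 0 = 0 by rewrite /redot /= !mulr0 addr0.
rewrite !d0 addr0 subr0; congr (_ + _).
  by apply: eq_Jform => // k hk; rewrite ramp_head.
rewrite (eq_bigr (fun=> L%:R^-1 ^+ 2 * redot (y m) (y m))).
  rewrite big_const_ord iter_addr addr0 -[_ *+ L]mulr_natl; by field.
move=> [i hi] _ /=; rewrite -addnS !ramp_tail subnS.
have -> : ((L - i).-1%:R : R) = (L - i)%:R - 1.
  by rewrite -subn1 natrB // subn_gt0.
by rewrite /redot !partsE /=; field.
Qed.

(** For L > 1/e the cost |y_m|^2 / L of the descent stays within the margin e of [morse_index]. *)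
Lemma morse_index_H N (e : R) (E : set R -> operator R) : 0 < e ->
  morse_index m (Jform threshold_diag m.+1) N e -> spectral_measure H E ->
  trace (E `]-oo, 0[%classic) = (N%:R)%:E /\
  exactly_simple_negative_eigenvalues H N.
Proof.
move=> e0 [f [G [fl fge Gl Glt]]] hE.
have [L hL] : exists L : nat, e^-1 < L%:R.
  by exists (Num.truncn e^-1).+1; rewrite truncnS_gt.
have L0 : (0 < L)%N by rewrite -(ltr_nat R); apply: lt_trans hL; rewrite invr_gt0.
pose f' j x := f j (rescale x).
pose G' c := unrescale (ramp L (G c)).
have rl : linear_op rescale.
  by move=> a x y; apply/funext => k; rewrite /rescale /axpy; case: eqP => _ //; ring.
have fl' j : (j < N)%N -> functional_on (@l2 R) (f' j).
  by move=> _ a x y _ _; rewrite /f' rl fl.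
have fge' x : l2 x -> (forall j, (j < N)%N -> f' j x = 0) ->
    0 <= complex.Re (inner (H x) x).
  by move=> hx hf; apply: H_form_ge0 => //; exact: fge.
have Gl' : linear_op G' by move=> a x y; rewrite /G' Gl ramp_linear unrescale_linear.
have Gl2 c : l2 (G' c) by exact: unrescale_ramp_l2.
have Glt' (c : cseq R) j : (j < N)%N -> c j != 0 ->
    complex.Re (inner (H (G' c)) (G' c)) < 0.
  move=> hj cj; rewrite H_form_ramp //.
  apply: le_lt_trans (Glt c j hj cj); rewrite lerD2l ler_wpM2r ?redot_ge0 //.
  by rewrite -[leRHS]invrK lef_pV2 ?posrE ?invr_gt0 ?ltr0n // ltW.
split.
  exact: (trace_eigenbasis H_l2 H_linear H_symm hE fl' fge' Gl' Gl2 Glt').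
exact: (negative_eigenvalues H_l2 H_linear H_symm hE fl' fge' Gl' Gl2 Glt'
  H_geom_simple).
Qed.

(** The determinant is affine in its last diagonal entry, with the preceding minor as slope. *)
Lemma cont_threshold : cont threshold_diag m.+1 =
  cont (free_diag mu) m.+1 - cont (free_diag mu) m.
Proof.
have e p : (p <= m)%N -> cont threshold_diag p = cont (free_diag mu) p.
  move=> hp; apply: eq_cont => k hk.
  by rewrite /threshold_diag ltn_eqF ?subr0 // (leq_trans hk).
rewrite !contS e // {1}/threshold_diag eqxx.
have pe p : (p <= m)%N -> pcont threshold_diag p = pcont (free_diag mu) p.
  by case: p => //= p hp; rewrite /pcont e // ltnW.
by rewrite pe // [true%:R]mulr1n mulrBl mul1r addrAC.
Qed.

Lemma H_resonance : cont threshold_diag m.+1 = 0 -> threshold_resonance H.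
Proof.
move=> hc; set d := free_diag mu.
have cE : cont d m.+1 = cont d m by apply/eqP; rewrite -subr_eq0 -cont_threshold hc.
pose Psi := unrescale (fun k => (cont d k)%:C).
have const j : cont d (m + j) = cont d m /\ cont d (m + j).+1 = cont d m.
  elim: j => [|j [h1 h2]]; first by rewrite addn0.
  rewrite addnS h2; split => //; rewrite contS h2 /= h1.
  by rewrite /d /free_diag /= entry_out ?ltnS ?leq_addr // addr0; ring.
exists Psi; split.
- move=> /(congr1 (fun f => f 0%N)); rewrite /Psi /unrescale /= cont0 rmorph1 mulr1.
  by move=> /eqP; rewrite (fmorph_eq0 (real_complex R)) invr_eq0 (negbTE sqrt2_neq0).
(* The entries are constant from m + 1 on. Starting at m would fail for m = 0, where the first entry
   carries the factor 1 / sqrt 2. *)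
- exists (\sum_(i < m.+2) Normc.normc (Psi i)) => k.
  have n0 z : 0 <= Normc.normc (z : C) by case: z => a b; rewrite sqrtr_ge0.
  wlog hk : k / (k < m.+2)%N => [wl|].
    have [hk|hk] := ltnP k m.+2; first exact: wl.
    suff -> : Psi k = Psi m.+1 by exact: wl.
    have k0 : (0 < k)%N by apply: leq_trans hk.
    rewrite /Psi /unrescale gtn_eqF //=; congr (_%:C).
    by rewrite -(subnKC (ltnW (ltnW hk))) (const _).1 cE.
  by rewrite (bigD1 (Ordinal hk)) //= lerDl sumr_ge0.
- apply/funext => k; rewrite H_opE.
  have s2 := sqrt2_sqr; have s0 := sqrt2_neq0.
  case: k => [|[|k]]; rewrite /Psi /unrescale /pred_term /= /offdiag /= /pot /=.
  + rewrite contS cont0 subr0 mulr1 /d /free_diag /=.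
    rewrite mulr0 add0r -!rmorphM -rmorphD; congr (_%:C).
    have -> : (Num.sqrt (2 : R))^-1 = Num.sqrt 2 / 2.
      by apply: (mulfI s0); rewrite mulfV // mulrA s2 mulfV.
    by field.
  + rewrite (contS _ 1) /pcont cont0 {2}/d /free_diag /=.
    rewrite -!rmorphM -!rmorphD; congr (_%:C).
    by rewrite mulr1 mulNr mulfV //; ring.
  + rewrite [cont d k.+3]contS /= /d /free_diag /=.
    by rewrite -!rmorphM -!rmorphD; congr (_%:C); ring.
Qed.

End JacobiOperator.

(** * Virtual levels and the graphs of Phi_(n-1) + 1 *)

Lemma cont_consecutive (R : realType) (d : nat -> R) n :
  cont d n = 0 -> cont d n.+1 = 0 -> False.
Proof.
elim: n => [|n IH] h; first by have := oner_neq0 R; rewrite -(cont0 d) h eqxx.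
rewrite contS h mulr0 sub0r => /eqP; rewrite oppr_eq0 => /eqP /= h'.
exact: IH h' h.
Qed.

Section VirtualLevel.
Variable R : realType.
Variables (m : nat) (mu : 'rV[R]_m.+1).

Lemma threshold_diag_dist (nu : 'rV[R]_m.+1) (e : R) k :
  (forall i j, `|mu i j - nu i j| < e) -> 0 < e ->
  `|threshold_diag nu k - threshold_diag mu k| <= e.
Proof.
move=> h e0.
have he j : `|entry nu j - entry mu j| <= e.
  rewrite /entry; case: insubP => [i _ _|_]; last by rewrite subrr normr0 ltW.
  by rewrite distrC ltW.
rewrite /threshold_diag /free_diag; case: eqP => _.
  by rewrite (_ : _ - _ = entry nu 0 - entry mu 0) //; ring.
by rewrite (_ : _ - _ = entry nu k - entry mu k) //; ring.
Qed.

(** By contraposition: one N and one e serve all potentials in a ball around [mu], so the trace is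
    constant there. *)
Lemma virtual_level_critical : virtual_level mu ->
  cont (threshold_diag mu) m.+1 = 0.
Proof.
move=> [E [hE]]; apply: contra_notP => /eqP h.
have [N [e [del [e0 del0 hst]]]] := morse_index_stable h.
have trE (nu : 'rV[R]_m.+1) : (forall i j, `|mu i j - nu i j| < del) ->
    trace (E nu `]-oo, 0[%classic) = (N%:R)%:E.
  move=> hnu; apply: (proj1 (morse_index_H e0 _ (hE nu))).
  by apply: hst => k _; exact: threshold_diag_dist.
have mumu : forall i j, `|mu i j - mu i j| < del by move=> i j; rewrite subrr normr0.
have hb : \forall nu \near mu, trace (E nu `]-oo, 0[%classic) = (N%:R)%:E.
  have : \forall nu \near mu, ball mu del nu by exact: nbhsx_ballx.
  by apply: filterS => nu [_ hnu]; apply: trE => i j; exact: hnu.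
suff : trace (E nu `]-oo, 0[%classic) @[nu --> mu] -->
    trace (E mu `]-oo, 0[%classic) by [].
rewrite (trE mu mumu); apply: (@cvg_near_cst _ _ _ _ (nbhs mu) (nbhs_filter mu)).
exact: hb.
Qed.

(** On the graph the last pivot mu_n - Phi_(n-1) is 1. Lowering the last diagonal entry by 1 makes
    it 0, so the index of the first n - 1 coordinates is kept. *)
Lemma graph_critical k : graph (fun nu : 'rV[R]_m => Phi nu + 1) (D m k) mu ->
  cont (threshold_diag mu) m.+1 = 0 /\
  has_negative_index m.+1 (Jform (threshold_diag mu) m.+1) k.
Proof.
move=> [/D_index[h1 _ [s ds sk]] hl].
rewrite cont_pt_init // in h1.
have hd i : (i < m)%N -> free_diag (pt_init mu) i = threshold_diag mu i.
  by move=> hi; rewrite /threshold_diag ltn_eqF // subr0 free_diag_pt_init.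
have c0 : cont (threshold_diag mu) m.+1 = 0.
  by rewrite cont_threshold cont_Phi // hl addrAC subrr add0r mulr1 subrr.
have hm : cont (threshold_diag mu) m != 0.
  rewrite -(eq_cont hd) cont_pt_init //.
split=> //.
have ds' : has_diagonal_form m (Jform (threshold_diag mu) m) s.
  by apply: eq_diagonal_form ds => // x; exact: eq_Jform.
have := diagonal_form_step hm ds'; rewrite c0 mul0r => ds2.
by exists (snoc s m 0) => //; rewrite negs_snoc sk ltxx addn0.
Qed.

Lemma graph_spectrum k : virtual_level mu ->
  graph (fun nu : 'rV[R]_m => Phi nu + 1) (D m k) mu ->
  threshold_resonance (H_op mu) /\ exactly_simple_negative_eigenvalues (H_op mu) k.
Proof.
move=> [E [hE _]] /graph_critical[c0 hk].
split; first exact: H_resonance.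
have [e e0 he] := morse_index_critical hk.
exact: (proj2 (morse_index_H e0 he (hE mu))).
Qed.

End VirtualLevel.

Theorem theorem6p2 (R : realType) (m : nat) (mu : 'rV[R]_m.+1) :
  virtual_level mu ->
  (exists! k : nat, (k <= m)%N /\
     graph (fun nu : 'rV[R]_m => Phi nu + 1) (D m k) mu) /\
  (forall k : nat, (k <= m)%N ->
     graph (fun nu : 'rV[R]_m => Phi nu + 1) (D m k) mu ->
     threshold_resonance (H_op mu) /\
     exactly_simple_negative_eigenvalues (H_op mu) k).
Proof.
move=> hv; split; last by move=> k _; exact: graph_spectrum.
have := virtual_level_critical hv; rewrite cont_threshold => /eqP.
rewrite subr_eq0 => /eqP hc.
(* Q_n = Q_(n-1) = 0 is impossible, as consecutive minors do not vanish together. *)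
have h0 : cont (free_diag mu) m != 0.
  apply/eqP => h0; have {}hc : cont (free_diag mu) m.+1 = 0 by rewrite hc.
  exact: cont_consecutive h0 hc.
have [k hk hD] : exists2 k, (k <= m)%N & D m k (pt_init mu).
  by apply: D_cover; rewrite cont_pt_init.
have gk : graph (fun nu : 'rV[R]_m => Phi nu + 1) (D m k) mu.
  split=> //; have := hc; rewrite cont_Phi // => /eqP.
  rewrite -[eqbRHS]mulr1 (inj_eq (mulfI h0)) subr_eq addrC => /eqP //.
(* Both k and k' count the negative eigenvalues of H_mu. *)
exists k; split => // k' [_ gk'].
have [_ [e1 _]] := graph_spectrum hv gk.
have [_ [e2 _]] := graph_spectrum hv gk'.
have : (`I_k #= `I_k')%card by apply: card_eq_trans e2; rewrite card_eq_sym.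
by move/card_eq_II.
Qed.
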